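(* Let $\rho:[t_0,\infty)\to M_n$ be a solution of the noncommutative Ricci flow $\frac{d}{dt}\rho(t)=-\triangle\log\rho(t)$ such that $\rho(t_0)$ is strictly positive with $\tau(\rho(t_0))=1$ (so $\rho(t)$ is a strictly positive density matrix for all $t\ge t_0$). Let $S(t)=-\tau(\rho(t)\log\rho(t))$ be the von Neumann entropy. Then either $\rho(t)=\frac1n 1$ for all $t$ (the maximum-entropy state, a fixed point of the flow), or $S$ is a strictly increasing function of $t$ on $[t_0,\infty)$ with $S(t)\to\log n$ as $t\to\infty$.
   Context: Let $n\ge 2$, let $m\in\{1,\dots,n-1\}$ be relatively prime to $n$, and set $q=e^{2\pi i m/n}$. Let $M_n$ be the algebra of complex $n\times n$ matrices with identity $1$. Let $u=\mathrm{diag}(1,q,\dots,q^{n-1})$ and let $v$ be the cyclic shift matrix with $v_{j,j+1}=1$ for $j=1,\dots,n-1$, $v_{n,1}=1$, other entries $0$. Let $x,y$ be any Hermitian matrices with $u=e^{\frac{2\pi i}{n}x}$ and $v=e^{\frac{2\pi i}{n}y}$. Define $\delta_1(a)=[y,a]$, $\delta_2(a)=-[x,a]$ and $\triangle=\delta_1^2+\delta_2^2$ on $M_n$. $\tau$ is the usual trace; $\log$ of a strictly positive matrix is defined by functional calculus. A density matrix is a positive matrix of trace $1$. Existence and uniqueness of the flow on $[t_0,\infty)$ for strictly positive initial data, together with preservation of the trace, hold. *)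

(* Defs.v *)
(* complex numbers as pairs of Stdlib reals, n x n complex
   matrices as functions nat -> nat -> C (only indices < n are meaningful). *)
From Stdlib Require Import Reals Lra Lia Arith.
Open Scope R_scope.

Definition C : Type := (R * R)%type.
Definition Cre (z : C) : R := fst z.
Definition Cim (z : C) : R := snd z.
Definition RtoC (r : R) : C := (r, 0).
Definition Czero : C := (0, 0).
Definition Cone : C := (1, 0).
Definition Cadd (a b : C) : C := (fst a + fst b, snd a + snd b).
Definition Copp (a : C) : C := (- fst a, - snd a).
Definition Csub (a b : C) : C := Cadd a (Copp b).
Definition Cmul (a b : C) : C :=
  (fst a * fst b - snd a * snd b, fst a * snd b + snd a * fst b).
Definition Cconj (a : C) : C := (fst a, - snd a).
Definition Cmod (a : C) : R := sqrt (fst a * fst a + snd a * snd a).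
Definition Cexpi (theta : R) : C := (cos theta, sin theta).
Fixpoint Cpow (z : C) (k : nat) : C :=
  match k with O => Cone | S k' => Cmul z (Cpow z k') end.

Fixpoint csum (f : nat -> C) (n : nat) : C :=
  match n with O => Czero | S k => Cadd (csum f k) (f k) end.

Definition Mat : Type := nat -> nat -> C.

Definition meq (n : nat) (A B : Mat) : Prop :=
  forall i j, (i < n)%nat -> (j < n)%nat -> A i j = B i j.

Definition mone : Mat := fun i j => if Nat.eqb i j then Cone else Czero.
Definition madd (A B : Mat) : Mat := fun i j => Cadd (A i j) (B i j).
Definition mopp (A : Mat) : Mat := fun i j => Copp (A i j).
Definition msub (A B : Mat) : Mat := madd A (mopp B).
Definition mscal (c : C) (A : Mat) : Mat := fun i j => Cmul c (A i j).
Definition mmul (n : nat) (A B : Mat) : Mat :=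
  fun i j => csum (fun k => Cmul (A i k) (B k j)) n.
Definition madj (A : Mat) : Mat := fun i j => Cconj (A j i).
Definition mdiag (d : nat -> C) : Mat :=
  fun i j => if Nat.eqb i j then d i else Czero.
Definition mtr (n : nat) (A : Mat) : C := csum (fun i => A i i) n.
Definition comm (n : nat) (A B : Mat) : Mat := msub (mmul n A B) (mmul n B A).

Definition hermitian (n : nat) (A : Mat) : Prop := meq n (madj A) A.
Definition unitary (n : nat) (U : Mat) : Prop := meq n (mmul n (madj U) U) mone.

Definition qform (n : nat) (A : Mat) (v : nat -> C) : C :=
  csum (fun i => Cmul (Cconj (v i)) (csum (fun j => Cmul (A i j) (v j)) n)) n.

Definition strictly_positive (n : nat) (A : Mat) : Prop :=
  hermitian n A /\
  forall v : nat -> C, (exists i, (i < n)%nat /\ v i <> Czero) ->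
    Cim (qform n A v) = 0 /\ Cre (qform n A v) > 0.

Definition is_fcalc (n : nat) (f : R -> C) (A B : Mat) : Prop :=
  exists (U : Mat) (d : nat -> R),
    unitary n U /\
    meq n A (mmul n (mmul n U (mdiag (fun i => RtoC (d i)))) (madj U)) /\
    meq n B (mmul n (mmul n U (mdiag (fun i => f (d i)))) (madj U)).

Definition is_log (n : nat) (A L : Mat) : Prop := is_fcalc n (fun r => RtoC (ln r)) A L.

Definition qroot (n m : nat) : C := Cexpi (2 * PI * INR m / INR n).
Definition umat (n m : nat) : Mat := mdiag (fun j => Cpow (qroot n m) j).
(* 0-indexed: v_{j,j+1} = 1 for j < n-1, v_{n-1,0} = 1 *)
Definition vmat (n : nat) : Mat :=
  fun i j => if Nat.eqb j (S i) then Cone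
             else if andb (Nat.eqb i (n - 1)) (Nat.eqb j 0) then Cone else Czero.

Definition delta1 (n : nat) (y : Mat) (a : Mat) : Mat := comm n y a.
Definition delta2 (n : nat) (x : Mat) (a : Mat) : Mat := mopp (comm n x a).
Definition lap (n : nat) (x y : Mat) (a : Mat) : Mat :=
  madd (delta1 n y (delta1 n y a)) (delta2 n x (delta2 n x a)).

(* D is the derivative of rho at t, relative to the domain [t0, +oo)
   (one-sided at t = t0), entrywise *)
Definition mderiv_on (n : nat) (t0 : R) (rho : R -> Mat) (t : R) (D : Mat) : Prop :=
  forall i j, (i < n)%nat -> (j < n)%nat ->
  forall eps, eps > 0 -> exists delta, delta > 0 /\
    forall h, h <> 0 -> Rabs h < delta -> t0 <= t + h ->
      Cmod (Csub (mscal (RtoC (/ h)) (msub (rho (t + h)) (rho t)) i j) (D i j)) < eps.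

(* Main.v *)
(** Along the flow, [dS/dt = tr(L triangle L) = ||[x,L]||^2 + ||[y,L]||^2] with [L = log rho]
    (Hilbert-Schmidt norms).  Commutators with [u] and [v] are dominated by those with [x] and
    [y]; since [u] and [v] together commute only with scalars, this gives a spectral gap
    [||L - c||^2 <= K dS/dt].  Klein's inequality against [1/n] bounds [log n - S] by
    [<rho - 1/n, L - c>], so [S] grows at a rate at least [eps^2/K] as long as
    [log n - S >= eps]; as [S <= log n], this forces [S -> log n].  Finally [1/n] cannot be
    reached in finite time unless the flow starts there, because [log] is Lipschitz near [1/n]
    and [||rho - 1/n||^2] therefore satisfies a linear differential inequality. *)
From Stdlib Require Import Reals Lra Lia Arith ZArith.
From Stdlib Require Import FunctionalExtensionality Setoid Morphisms Rderiv.
(* [Defs] comes last so that [C] denotes its complex numbers, not the real binomial. *)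
Require Import Defs.
Open Scope R_scope.

(** * Complex matrices and the Hilbert-Schmidt inner product *)

(** The eigenvalues of rho(t) have no uniform positive lower bound, so log need not be uniformly
    Lipschitz along the flow. Lipschitz estimates are therefore made only near a fixed matrix:
    rho(t) when the entropy is differentiated, 1/n when finite-time arrival is excluded. Convergence
    uses only a lower bound on ||L - c||, to which a large [L] does no harm. [L] is given time by
    time as a logarithm, with no regularity in t, so dS/dt is not obtained by differentiating [L]:
    Klein's inequality in both directions traps the increments of tr(rho L) between expressions
    linear in the increment of rho. Scalar inequalities become matrix inequalities by one device:
    matrices diagonal in the bases U and V are compared through a double sum over pairs of
    eigenvalues, with nonnegative weights given by squared overlaps of eigenvectors. Arrival at 1/n
    has to be excluded because strict growth on every interval is derived from dS/dt > 0 at all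
    times, and dS/dt vanishes exactly at 1/n. *)

Ltac cdestr := intros; repeat match goal with z : C |- _ => destruct z end;
  unfold Csub, Cadd, Cmul, Copp, Cconj, Czero, Cone, RtoC, Cre, Cim in *; simpl.
Ltac csolve := cdestr; try (apply f_equal2); try ring.

Lemma C_ring : ring_theory Czero Cone Cadd Cmul Csub Copp (@eq C).
Proof. split; csolve. Qed.
Add Ring C_ring : C_ring.

(** * Finite sums *)

Fixpoint rsum (f : nat -> R) (n : nat) : R :=
  match n with O => 0 | S k => rsum f k + f k end.

Lemma csum_ext (f g : nat -> C) n :
  (forall i, (i < n)%nat -> f i = g i) -> csum f n = csum g n.
Proof.
  induction n as [|n IH]; simpl; intros H; auto.
  rewrite IH, H by auto with arith; auto.
Qed.

Lemma csum_add f g n :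
  csum (fun i => Cadd (f i) (g i)) n = Cadd (csum f n) (csum g n).
Proof. induction n as [|n IH]; simpl; [|rewrite IH]; ring. Qed.

Lemma csum_mul_l c f n : csum (fun i => Cmul c (f i)) n = Cmul c (csum f n).
Proof. induction n as [|n IH]; simpl; [|rewrite IH]; ring. Qed.

Lemma csum_mul_r c f n : csum (fun i => Cmul (f i) c) n = Cmul (csum f n) c.
Proof. induction n as [|n IH]; simpl; [|rewrite IH]; ring. Qed.

Lemma csum_opp f n : csum (fun i => Copp (f i)) n = Copp (csum f n).
Proof. induction n as [|n IH]; simpl; [|rewrite IH]; ring. Qed.

Lemma csum_zero n : csum (fun _ => Czero) n = Czero.
Proof. induction n as [|n IH]; simpl; [|rewrite IH]; ring. Qed.

Lemma csum_swap (f : nat -> nat -> C) n m :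
  csum (fun i => csum (fun j => f i j) m) n = csum (fun j => csum (fun i => f i j) n) m.
Proof.
  induction n as [|n IH]; simpl.
  - now rewrite csum_zero.
  - now rewrite IH, csum_add.
Qed.

Lemma csum_conj f n : Cconj (csum f n) = csum (fun i => Cconj (f i)) n.
Proof.
  induction n as [|n IH]; simpl; [csolve|].
  rewrite <- IH. unfold Cconj, Cadd; simpl. f_equal; ring.
Qed.

Lemma csum_single f n k : (k < n)%nat ->
  (forall i, (i < n)%nat -> i <> k -> f i = Czero) -> csum f n = f k.
Proof.
  induction n as [|n IH]; intros Hk Hf; [lia|]; simpl.
  destruct (Nat.eq_dec k n) as [->|Hne].
  - rewrite (csum_ext f (fun _ => Czero)), csum_zero by (intros; apply Hf; lia). ring.
  - rewrite IH, (Hf n) by (intros; try apply Hf; lia). ring.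
Qed.

Lemma Cre_csum f n : Cre (csum f n) = rsum (fun i => Cre (f i)) n.
Proof. induction n as [|n IH]; simpl; auto. rewrite <- IH. reflexivity. Qed.

Lemma rsum_ext (f g : nat -> R) n :
  (forall i, (i < n)%nat -> f i = g i) -> rsum f n = rsum g n.
Proof.
  induction n as [|n IH]; simpl; intros H; auto.
  rewrite IH, H by auto with arith; auto.
Qed.

Lemma rsum_plus f g n : rsum (fun i => f i + g i) n = rsum f n + rsum g n.
Proof. induction n as [|n IH]; simpl; [|rewrite IH]; ring. Qed.

Lemma rsum_scal c f n : rsum (fun i => c * f i) n = c * rsum f n.
Proof. induction n as [|n IH]; simpl; [|rewrite IH]; ring. Qed.

Lemma rsum_const c n : rsum (fun _ => c) n = INR n * c.
Proof. induction n as [|n IH]; [simpl; ring|]. rewrite S_INR. simpl. rewrite IH; ring. Qed.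

Lemma rsum_le f g n : (forall i, (i < n)%nat -> f i <= g i) -> rsum f n <= rsum g n.
Proof.
  induction n as [|n IH]; simpl; intros H; [lra|].
  specialize (IH (fun i Hi => H i (Nat.lt_lt_succ_r _ _ Hi))).
  specialize (H n (Nat.lt_succ_diag_r n)). lra.
Qed.

Lemma rsum_nonneg f n : (forall i, (i < n)%nat -> 0 <= f i) -> 0 <= rsum f n.
Proof.
  intros H. pose proof (rsum_le (fun _ => 0) f n H) as Hle.
  rewrite rsum_const in Hle. lra.
Qed.

Lemma rsum_swap (f : nat -> nat -> R) n m :
  rsum (fun i => rsum (fun j => f i j) m) n = rsum (fun j => rsum (fun i => f i j) n) m.
Proof.
  induction n as [|n IH]; simpl.
  - rewrite rsum_const; ring.
  - now rewrite IH, rsum_plus.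
Qed.

Lemma rsum_term_le f n k : (forall i, (i < n)%nat -> 0 <= f i) -> (k < n)%nat ->
  f k <= rsum f n.
Proof.
  induction n as [|n IH]; simpl; intros H Hk; [lia|].
  assert (H' : forall i, (i < n)%nat -> 0 <= f i) by (intros; apply H; lia).
  destruct (Nat.eq_dec k n) as [->|Hne].
  - pose proof (rsum_nonneg f n H'). lra.
  - specialize (IH H' ltac:(lia)). specialize (H n ltac:(lia)). lra.
Qed.

(** * Matrix algebra modulo entries outside the n x n block *)

#[global] Instance meq_equiv n : Equivalence (meq n).
Proof.
  split; red; unfold meq.
  - reflexivity.
  - intros A B H i j Hi Hj. symmetry; auto.
  - intros A B D H1 H2 i j Hi Hj. now rewrite H1, H2.
Qed.

#[global] Instance mmul_proper n : Proper (meq n ==> meq n ==> meq n) (mmul n).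
Proof.
  intros A A' HA B B' HB i j Hi Hj. apply csum_ext; intros k Hk.
  now rewrite HA, HB.
Qed.

#[global] Instance madd_proper n : Proper (meq n ==> meq n ==> meq n) madd.
Proof. intros A A' HA B B' HB i j Hi Hj. unfold madd. now rewrite HA, HB. Qed.

#[global] Instance mopp_proper n : Proper (meq n ==> meq n) mopp.
Proof. intros A A' HA i j Hi Hj. unfold mopp. now rewrite HA. Qed.

#[global] Instance msub_proper n : Proper (meq n ==> meq n ==> meq n) msub.
Proof. intros A A' HA B B' HB. unfold msub. now rewrite HA, HB. Qed.

#[global] Instance mscal_proper n c : Proper (meq n ==> meq n) (mscal c).
Proof. intros A A' HA i j Hi Hj. unfold mscal. now rewrite HA. Qed.

#[global] Instance madj_proper n : Proper (meq n ==> meq n) madj.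
Proof. intros A A' HA i j Hi Hj. unfold madj. now rewrite HA. Qed.

#[global] Instance mtr_proper n : Proper (meq n ==> eq) (mtr n).
Proof. intros A A' HA. apply csum_ext; auto. Qed.

#[global] Instance comm_proper n : Proper (meq n ==> meq n ==> meq n) (comm n).
Proof. intros A A' HA B B' HB. unfold comm. now rewrite HA, HB. Qed.

#[global] Instance lap_proper n : Proper (meq n ==> meq n ==> meq n ==> meq n) (lap n).
Proof.
  intros x x' Hx y y' Hy A A' HA. unfold lap, delta1, delta2. now rewrite Hx, Hy, HA.
Qed.

(** Identities that do not involve the unit hold at all indices, hence as Leibniz equalities by
    extensionality. Those involving [mone] hold only up to [meq], since a product by [mone] is
    truncated at [n]. *)
Ltac mext := apply functional_extensionality; intro; apply functional_extensionality; intro.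

Lemma mmul_assoc n A B D : mmul n (mmul n A B) D = mmul n A (mmul n B D).
Proof.
  mext. unfold mmul.
  rewrite (csum_ext _ (fun k => csum (fun l => Cmul (A x l) (Cmul (B l k) (D k x0))) n)).
  2: { intros; rewrite <- csum_mul_r. apply csum_ext; intros; ring. }
  rewrite csum_swap. apply csum_ext; intros. now rewrite csum_mul_l.
Qed.

Lemma mmul_madd_l n A B D : mmul n (madd A B) D = madd (mmul n A D) (mmul n B D).
Proof. mext. unfold mmul, madd. rewrite <- csum_add. apply csum_ext; intros; ring. Qed.

Lemma mmul_madd_r n A B D : mmul n A (madd B D) = madd (mmul n A B) (mmul n A D).
Proof. mext. unfold mmul, madd. rewrite <- csum_add. apply csum_ext; intros; ring. Qed.

Lemma mmul_mopp_l n A B : mmul n (mopp A) B = mopp (mmul n A B).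
Proof. mext. unfold mmul, mopp. rewrite <- csum_opp. apply csum_ext; intros; ring. Qed.

Lemma mmul_mopp_r n A B : mmul n A (mopp B) = mopp (mmul n A B).
Proof. mext. unfold mmul, mopp. rewrite <- csum_opp. apply csum_ext; intros; ring. Qed.

Lemma mmul_msub_l n A B D : mmul n (msub A B) D = msub (mmul n A D) (mmul n B D).
Proof. unfold msub. now rewrite mmul_madd_l, mmul_mopp_l. Qed.

Lemma mmul_msub_r n A B D : mmul n A (msub B D) = msub (mmul n A B) (mmul n A D).
Proof. unfold msub. now rewrite mmul_madd_r, mmul_mopp_r. Qed.

Lemma mmul_mdiag_l n d A i j : (i < n)%nat -> mmul n (mdiag d) A i j = Cmul (d i) (A i j).
Proof.
  intros Hi. unfold mmul, mdiag. rewrite (csum_single _ n i); auto.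
  - now rewrite Nat.eqb_refl.
  - intros k _ Hk. replace (Nat.eqb i k) with false; [ring|].
    symmetry; apply Nat.eqb_neq; auto.
Qed.

Lemma mmul_mdiag_r n d A i j : (j < n)%nat -> mmul n A (mdiag d) i j = Cmul (A i j) (d j).
Proof.
  intros Hj. unfold mmul, mdiag. rewrite (csum_single _ n j); auto.
  - now rewrite Nat.eqb_refl.
  - intros k _ Hk. replace (Nat.eqb k j) with false; [ring|].
    symmetry; apply Nat.eqb_neq; auto.
Qed.

Lemma mmul_1_l n A : meq n (mmul n mone A) A.
Proof.
  intros i j Hi Hj. change mone with (mdiag (fun _ => Cone)).
  rewrite mmul_mdiag_l by auto. ring.
Qed.

Lemma mmul_1_r n A : meq n (mmul n A mone) A.
Proof.
  intros i j Hi Hj. change mone with (mdiag (fun _ => Cone)).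
  rewrite mmul_mdiag_r by auto. ring.
Qed.

Lemma madj_invol A : madj (madj A) = A.
Proof. mext. unfold madj, Cconj; simpl. destruct (A x x0); simpl. f_equal; ring. Qed.

Lemma Cconj_mul a b : Cconj (Cmul a b) = Cmul (Cconj a) (Cconj b).
Proof. csolve. Qed.

Lemma madj_mmul n A B : madj (mmul n A B) = mmul n (madj B) (madj A).
Proof.
  mext. unfold madj, mmul. rewrite csum_conj. apply csum_ext; intros.
  rewrite Cconj_mul. ring.
Qed.

Lemma madj_msub A B : madj (msub A B) = msub (madj A) (madj B).
Proof. mext. unfold madj, msub, madd, mopp. csolve. Qed.

Lemma mtr_mmul_comm n A B : mtr n (mmul n A B) = mtr n (mmul n B A).
Proof.
  unfold mtr, mmul. rewrite csum_swap. apply csum_ext; intros.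
  apply csum_ext; intros; ring.
Qed.

Lemma mtr_msub n A B : mtr n (msub A B) = Csub (mtr n A) (mtr n B).
Proof. unfold mtr, msub, madd, mopp, Csub. now rewrite csum_add, csum_opp. Qed.

(* real part of the Hilbert-Schmidt inner product *)
Definition ip (n : nat) (A B : Mat) : R :=
  rsum (fun i => rsum (fun j => Cre (A i j) * Cre (B i j) + Cim (A i j) * Cim (B i j)) n) n.

(** The squared Hilbert-Schmidt norm; all estimates are made on squares, without square roots. *)
Definition fro (n : nat) (A : Mat) : R := ip n A A.

#[global] Instance ip_proper n : Proper (meq n ==> meq n ==> eq) (ip n).
Proof.
  intros A A' HA B B' HB. apply rsum_ext; intros. apply rsum_ext; intros.
  now rewrite HA, HB.
Qed.

#[global] Instance fro_proper n : Proper (meq n ==> eq) (fro n).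
Proof. intros A A' HA. unfold fro. now rewrite HA. Qed.

Lemma ip_mtr n A B : ip n A B = Cre (mtr n (mmul n (madj A) B)).
Proof.
  unfold ip, mtr, mmul. rewrite Cre_csum, rsum_swap. apply rsum_ext; intros.
  rewrite Cre_csum. apply rsum_ext; intros. unfold madj, Cmul, Cconj, Cre, Cim; simpl. ring.
Qed.

Ltac ip_linear := intros; unfold ip;
  rewrite <- ?rsum_scal, <- ?rsum_plus; apply rsum_ext; intros;
  rewrite <- ?rsum_scal, <- ?rsum_plus; apply rsum_ext; intros;
  unfold msub, madd, mopp, mscal, Cadd, Copp, Cmul, RtoC, Cre, Cim; simpl; ring.

Lemma ip_sym n A B : ip n A B = ip n B A.
Proof. ip_linear. Qed.

Lemma ip_madd_l n A B D : ip n (madd A B) D = ip n A D + ip n B D.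
Proof. ip_linear. Qed.

Lemma ip_mopp_l n A D : ip n (mopp A) D = - ip n A D.
Proof. replace (- ip n A D) with (-1 * ip n A D) by ring. ip_linear. Qed.

Lemma ip_msub_l n A B D : ip n (msub A B) D = ip n A D - ip n B D.
Proof. unfold msub. rewrite ip_madd_l, ip_mopp_l. ring. Qed.

Lemma ip_msub_r n A B D : ip n A (msub B D) = ip n A B - ip n A D.
Proof. rewrite ip_sym, ip_msub_l, 2(ip_sym n A). ring. Qed.

Lemma ip_mopp_r n A D : ip n A (mopp D) = - ip n A D.
Proof. now rewrite ip_sym, ip_mopp_l, ip_sym. Qed.

Lemma ip_mscal_l n c A D : ip n (mscal (RtoC c) A) D = c * ip n A D.
Proof. ip_linear. Qed.

Lemma ip_mscal_r n c A D : ip n A (mscal (RtoC c) D) = c * ip n A D.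
Proof. now rewrite ip_sym, ip_mscal_l, ip_sym. Qed.

Definition Cnorm2 (z : C) : R := Cre z * Cre z + Cim z * Cim z.

Lemma Cnorm2_nonneg z : 0 <= Cnorm2 z.
Proof. unfold Cnorm2. nra. Qed.

Lemma Cnorm2_eq0 z : Cnorm2 z = 0 -> z = Czero.
Proof. destruct z as [a b]; unfold Cnorm2, Cre, Cim, Czero; simpl. intros. f_equal; nra. Qed.

Lemma Cnorm2_mul a b : Cnorm2 (Cmul a b) = Cnorm2 a * Cnorm2 b.
Proof. unfold Cnorm2; cdestr. ring. Qed.

Lemma fro_sum n A : fro n A = rsum (fun i => rsum (fun j => Cnorm2 (A i j)) n) n.
Proof. reflexivity. Qed.

Lemma rsum2_nonneg (f : nat -> nat -> R) n :
  (forall i j, (i < n)%nat -> (j < n)%nat -> 0 <= f i j) ->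
  0 <= rsum (fun i => rsum (fun j => f i j) n) n.
Proof. intros; apply rsum_nonneg; intros; apply rsum_nonneg; auto. Qed.

Lemma fro_nonneg n A : 0 <= fro n A.
Proof. apply rsum2_nonneg; intros. apply Cnorm2_nonneg. Qed.

Lemma fro_entry n A i j : (i < n)%nat -> (j < n)%nat -> Cnorm2 (A i j) <= fro n A.
Proof.
  intros Hi Hj. rewrite fro_sum.
  apply Rle_trans with (rsum (fun j => Cnorm2 (A i j)) n).
  - apply (rsum_term_le (fun j => Cnorm2 (A i j))); auto using Cnorm2_nonneg.
  - apply (rsum_term_le (fun i => rsum (fun j => Cnorm2 (A i j)) n)); auto.
    intros; apply rsum_nonneg; auto using Cnorm2_nonneg.
Qed.

Definition mzero : Mat := fun _ _ => Czero.

Lemma fro_eq0 n A : fro n A = 0 -> meq n A mzero.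
Proof.
  intros H i j Hi Hj. apply Cnorm2_eq0.
  pose proof (fro_entry n A i j Hi Hj). pose proof (Cnorm2_nonneg (A i j)). lra.
Qed.

Lemma fro_mzero n : fro n mzero = 0.
Proof.
  rewrite fro_sum. rewrite (rsum_ext _ (fun _ => 0)), rsum_const; [ring|].
  intros. rewrite (rsum_ext _ (fun _ => 0)), rsum_const; [ring|].
  intros. unfold Cnorm2, mzero, Cre, Cim; simpl; ring.
Qed.

Lemma meq_msub0 n A B : meq n (msub A B) mzero <-> meq n A B.
Proof.
  split; intros H i j Hi Hj.
  - assert (E : A i j = Cadd (msub A B i j) (B i j)) by (unfold msub, madd, mopp; ring).
    rewrite E, H by auto. unfold mzero. ring.
  - unfold msub, madd, mopp. rewrite H by auto. unfold mzero. ring.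
Qed.

Lemma fro_msub_eq0 n A B : fro n (msub A B) = 0 <-> meq n A B.
Proof.
  split; intros H.
  - now apply meq_msub0, fro_eq0.
  - rewrite <- meq_msub0 in H. rewrite H. apply fro_mzero.
Qed.

Lemma fro_mopp n A : fro n (mopp A) = fro n A.
Proof. unfold fro. rewrite ip_mopp_l, ip_mopp_r. ring. Qed.

(* AM-GM: [<c A - B, c A - B> >= 0] *)
Lemma ip_le_fro n c A B : 0 < c -> 2 * ip n A B <= c * fro n A + fro n B / c.
Proof.
  intros Hc. pose proof (fro_nonneg n (msub (mscal (RtoC c) A) B)) as H.
  unfold fro in *. rewrite ip_msub_l, !ip_msub_r, !ip_mscal_l, !ip_mscal_r in H.
  rewrite (ip_sym n B A) in H.
  apply Rmult_le_reg_l with c; auto. field_simplify; lra.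
Qed.

Lemma fro_madd_le n A B : fro n (madd A B) <= 2 * fro n A + 2 * fro n B.
Proof.
  unfold fro. rewrite ip_madd_l, 2(ip_sym n _ (madd A B)), !ip_madd_l.
  pose proof (fro_nonneg n (msub A B)) as H.
  unfold fro in H. rewrite ip_msub_l, !ip_msub_r in H. lra.
Qed.

Lemma ip_mmul_l n A X Y : ip n (mmul n A X) Y = ip n X (mmul n (madj A) Y).
Proof. now rewrite !ip_mtr, madj_mmul, mmul_assoc. Qed.

Lemma ip_mmul_r n A X Y : ip n (mmul n X A) Y = ip n X (mmul n Y (madj A)).
Proof. rewrite !ip_mtr, madj_mmul, mmul_assoc, mtr_mmul_comm. now rewrite mmul_assoc. Qed.

(** By cyclicity of the trace, left and right multiplication by a Hermitian matrix are both
    self-adjoint for [ip]. *)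
Lemma ip_comm n y A B : hermitian n y -> ip n (comm n y A) B = ip n A (comm n y B).
Proof.
  unfold hermitian. intros Hy. unfold comm. rewrite ip_msub_l, ip_msub_r, ip_mmul_l, ip_mmul_r.
  now rewrite Hy.
Qed.

(** This is the Dirichlet form: [delta1] and [delta2] are self-adjoint, so the Laplacian is a sum of
    squares and a nonnegative operator. It becomes the entropy production when [A] is the
    logarithm. *)
Lemma ip_lap n x y A : hermitian n x -> hermitian n y ->
  ip n (lap n x y A) A = fro n (comm n x A) + fro n (comm n y A).
Proof.
  intros Hx Hy. unfold lap, delta1, delta2, fro. rewrite ip_madd_l, (ip_comm n y) by auto.
  rewrite ip_mopp_l, (ip_comm n x), ip_mopp_l by auto. ring.
Qed.

Lemma comm_scalar n y c : meq n (comm n y (mscal c mone)) mzero.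
Proof.
  unfold comm. rewrite meq_msub0. intros i j Hi Hj.
  replace (mscal c mone) with (mdiag (fun _ => c)).
  - rewrite mmul_mdiag_l, mmul_mdiag_r by auto. ring.
  - mext. unfold mscal, mdiag, mone. destruct (Nat.eqb x x0); ring.
Qed.

Lemma comm_msub n y A B : comm n y (msub A B) = msub (comm n y A) (comm n y B).
Proof.
  unfold comm. rewrite mmul_msub_l, mmul_msub_r. mext. unfold msub, madd, mopp. ring.
Qed.

(* The projection [1 - U U*] has trace 0, hence vanishes. *)
Lemma unitary_adj n U : unitary n U -> meq n (mmul n U (madj U)) mone.
Proof.
  intros HU. red in HU. set (P := mmul n U (madj U)).
  assert (HP : meq n (mmul n P P) P).
  { unfold P. rewrite mmul_assoc, <- (mmul_assoc n (madj U) U), HU, mmul_1_l. reflexivity. }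
  assert (HPa : madj P = P) by (unfold P; now rewrite madj_mmul, madj_invol).
  assert (H1a : madj mone = mone).
  { mext. unfold madj, mone. rewrite Nat.eqb_sym. destruct (Nat.eqb x x0); csolve. }
  symmetry. apply fro_msub_eq0. unfold fro.
  rewrite ip_mtr, madj_msub, HPa, H1a, mmul_msub_r, !mmul_msub_l.
  rewrite !mmul_1_r, mmul_1_l, HP, !mtr_msub. unfold P.
  rewrite (mtr_mmul_comm n U), HU. cdestr. destruct (mtr n mone). simpl. ring.
Qed.

Lemma fro_unitary_l n U X : unitary n U -> fro n (mmul n (madj U) X) = fro n X.
Proof.
  intros HU. unfold fro. rewrite ip_mmul_l, madj_invol, <- mmul_assoc.
  now rewrite (unitary_adj n U), mmul_1_l.
Qed.

Lemma fro_unitary_r n V X : unitary n V -> fro n (mmul n X V) = fro n X.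
Proof.
  intros HV. unfold fro. rewrite ip_mmul_r, mmul_assoc.
  now rewrite (unitary_adj n V), mmul_1_r.
Qed.

(** * Double operator sums *)

Definition mconj_diag (n : nat) (U : Mat) (a : nat -> C) : Mat :=
  mmul n (mmul n U (mdiag a)) (madj U).

(* Double operator sum: in the two eigenbases, [f(A) X - X f(B)] is the Schur
   multiple of [X] by [f(a_i) - f(b_j)]. *)
Lemma fro_intertwine n U V a b X : unitary n U -> unitary n V ->
  fro n (msub (mmul n (mconj_diag n U a) X) (mmul n X (mconj_diag n V b))) =
  rsum (fun i => rsum (fun j =>
    Cnorm2 (Csub (a i) (b j)) * Cnorm2 (mmul n (mmul n (madj U) X) V i j)) n) n.
Proof.
  intros HU HV. rewrite <- (fro_unitary_l n U), <- (fro_unitary_r n V) by auto.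
  set (W := mmul n (mmul n (madj U) X) V).
  assert (E : meq n (mmul n (mmul n (madj U) (msub (mmul n (mconj_diag n U a) X)
                (mmul n X (mconj_diag n V b)))) V)
              (msub (mmul n (mdiag a) W) (mmul n W (mdiag b)))).
  { rewrite mmul_msub_r, mmul_msub_l. apply msub_proper.
    - unfold mconj_diag, W. rewrite !mmul_assoc, <- (mmul_assoc n (madj U) U).
      red in HU. now rewrite HU, mmul_1_l.
    - unfold mconj_diag, W. rewrite !mmul_assoc. red in HV. now rewrite HV, mmul_1_r. }
  rewrite E, fro_sum. apply rsum_ext; intros i Hi. apply rsum_ext; intros j Hj.
  rewrite <- Cnorm2_mul. f_equal. unfold msub at 1, madd, mopp.
  rewrite mmul_mdiag_l, mmul_mdiag_r by auto. ring.
Qed.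

(** Transfers a scalar inequality to matrices. With [X] the identity it compares differences of
    matrices diagonal in different bases; with [U = V] it compares commutators with [X]. *)
Lemma fro_intertwine_le n U V a b f g X K : unitary n U -> unitary n V ->
  (forall i j, (i < n)%nat -> (j < n)%nat ->
     Cnorm2 (Csub (f i) (g j)) <= K * Cnorm2 (Csub (a i) (b j))) ->
  fro n (msub (mmul n (mconj_diag n U f) X) (mmul n X (mconj_diag n V g))) <=
  K * fro n (msub (mmul n (mconj_diag n U a) X) (mmul n X (mconj_diag n V b))).
Proof.
  intros HU HV H. rewrite !fro_intertwine by auto.
  rewrite <- rsum_scal. apply rsum_le; intros i Hi.
  rewrite <- rsum_scal. apply rsum_le; intros j Hj.
  pose proof (Cnorm2_nonneg (mmul n (mmul n (madj U) X) V i j)).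
  specialize (H i j Hi Hj). nra.
Qed.

(** The weight is the squared overlap of the i-th eigenvector in [U] with the j-th in [V]; by
    [unitary_row] these weights sum to 1 along each row. *)
Lemma ip_mconj_diag n U V a b : unitary n U -> unitary n V ->
  ip n (mconj_diag n U (fun i => RtoC (a i))) (mconj_diag n V (fun i => RtoC (b i))) =
  rsum (fun i => rsum (fun j => a i * b j * Cnorm2 (mmul n (madj U) V i j)) n) n.
Proof.
  intros HU HV. unfold mconj_diag.
  rewrite (mmul_assoc n U), ip_mmul_l, <- (mmul_assoc n (madj U)), (ip_sym n).
  rewrite ip_mmul_r, madj_invol, <- (mmul_assoc n (madj U)).
  apply rsum_ext; intros i Hi. apply rsum_ext; intros j Hj.
  rewrite (mmul_assoc n (mdiag _)), mmul_mdiag_l, mmul_mdiag_r by auto.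
  unfold Cnorm2, Cmul, RtoC, Cre, Cim; simpl; ring.
Qed.

Lemma unitary_row n W i : unitary n W -> (i < n)%nat ->
  rsum (fun j => Cnorm2 (W i j)) n = 1.
Proof.
  intros HW Hi. pose proof (unitary_adj n W HW i i Hi Hi) as E.
  unfold mone in E. rewrite Nat.eqb_refl in E. apply (f_equal Cre) in E.
  unfold mmul in E. rewrite Cre_csum in E. unfold Cone, Cre at 2 in E; simpl in E.
  rewrite <- E. apply rsum_ext; intros. unfold Cnorm2, madj, Cmul, Cconj, Cre, Cim; simpl. ring.
Qed.

Lemma unitary_mul n U V : unitary n U -> unitary n V -> unitary n (mmul n (madj U) V).
Proof.
  intros HU HV. red. rewrite madj_mmul, madj_invol, mmul_assoc, <- (mmul_assoc n U).
  now rewrite (unitary_adj n U), mmul_1_l.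
Qed.

Lemma unitary_mone n : unitary n mone.
Proof.
  red. rewrite mmul_1_r. intros i j _ _. unfold madj, mone. rewrite Nat.eqb_sym.
  destruct (Nat.eqb i j); csolve.
Qed.

(** * Logarithms of strictly positive matrices *)

Lemma rsum_single f n k : (k < n)%nat ->
  (forall i, (i < n)%nat -> i <> k -> f i = 0) -> rsum f n = f k.
Proof.
  intros Hk Hf. pose proof (csum_single (fun i => RtoC (f i)) n k Hk) as H.
  apply (f_equal Cre) in H.
  - rewrite Cre_csum in H. exact H.
  - intros. rewrite Hf; auto.
Qed.

Lemma finite_bound (f : nat -> R) n : exists K, 0 < K /\ forall i, (i < n)%nat -> f i <= K.
Proof.
  exists (1 + rsum (fun i => Rabs (f i)) n).
  assert (H0 : 0 <= rsum (fun i => Rabs (f i)) n) by (apply rsum_nonneg; intros; apply Rabs_pos).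
  split; [lra|]. intros i Hi.
  pose proof (rsum_term_le (fun i => Rabs (f i)) n i (fun i _ => Rabs_pos (f i)) Hi).
  pose proof (Rle_abs (f i)). simpl in *. lra.
Qed.

Lemma finite_bound2 (f : nat -> nat -> R) n :
  exists K, 0 < K /\ forall i j, (i < n)%nat -> (j < n)%nat -> f i j <= K.
Proof.
  exists (1 + rsum (fun i => rsum (fun j => Rabs (f i j)) n) n).
  split.
  - pose proof (rsum2_nonneg (fun i j => Rabs (f i j)) n (fun i j _ _ => Rabs_pos _)). lra.
  - intros i j Hi Hj.
    pose proof (rsum_term_le (fun j => Rabs (f i j)) n j (fun j _ => Rabs_pos _) Hj) as H1.
    pose proof (rsum_term_le (fun i => rsum (fun j => Rabs (f i j)) n) n i
      (fun i _ => rsum_nonneg _ n (fun j _ => Rabs_pos (f i j))) Hi) as H2.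
    pose proof (Rle_abs (f i j)). simpl in *. lra.
Qed.

(** An upper bound for the reciprocals is inverted. [P] selects the pairs at issue: the off-diagonal
    ones for the spectral gap, all of them for the least eigenvalue. *)
Lemma finite_pos_min2 (f : nat -> nat -> R) n (P : nat -> nat -> Prop) :
  (forall i j, (i < n)%nat -> (j < n)%nat -> P i j -> 0 < f i j) ->
  exists mu, 0 < mu /\ forall i j, (i < n)%nat -> (j < n)%nat -> P i j -> mu <= f i j.
Proof.
  intros H. destruct (finite_bound2 (fun i j => / f i j) n) as (K & HK & HKf).
  exists (/ K). split; [now apply Rinv_0_lt_compat|].
  intros i j Hi Hj HP. specialize (H i j Hi Hj HP). specialize (HKf i j Hi Hj).
  rewrite <- (Rinv_inv (f i j)). apply Rinv_le_contravar; auto.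
  now apply Rinv_0_lt_compat.
Qed.

(** * Scalar inequalities for the logarithm *)

Lemma ln_le_sub1 x : 0 < x -> ln x <= x - 1.
Proof. intros Hx. pose proof (exp_ineq1_le (ln x)) as H. rewrite exp_ln in H by auto. lra. Qed.

Lemma ln_sub_le a b : 0 < a -> 0 < b -> ln b - ln a <= (b - a) / a.
Proof.
  intros Ha Hb. replace (ln b - ln a) with (ln (b / a))
    by (unfold Rdiv; rewrite ln_mult, ln_Rinv by auto using Rinv_0_lt_compat; ring).
  replace ((b - a) / a) with (b / a - 1) by (field; lra).
  apply ln_le_sub1. now apply Rdiv_lt_0_compat.
Qed.

(** The convex function t ln t lies above its tangent line at [b]; this is the scalar case of
    Klein's inequality. *)
Lemma gibbs a b : 0 < a -> 0 < b -> a * ln b + a - b <= a * ln a.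
Proof.
  intros Ha Hb. pose proof (ln_sub_le a b Ha Hb) as H.
  apply (Rmult_le_compat_l a) in H; [|lra].
  replace (a * ((b - a) / a)) with (b - a) in H by (field; lra). lra.
Qed.

Lemma ln_lipschitz l a b : 0 < l -> l <= a -> l <= b ->
  (ln a - ln b) * (ln a - ln b) <= / (l * l) * ((a - b) * (a - b)).
Proof.
  intros Hl.
  assert (W : forall a b, l <= a -> a <= b ->
    (ln a - ln b) * (ln a - ln b) <= / (l * l) * ((a - b) * (a - b))).
  { clear a b. intros a b Ha Hab.
    assert (H0 : ln a <= ln b).
    { destruct Hab as [H|H]; [left; apply ln_increasing; lra | subst; lra]. }
    pose proof (ln_sub_le a b ltac:(lra) ltac:(lra)) as H1.
    assert (H2 : (b - a) / a <= (b - a) / l).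
    { apply Rmult_le_compat_l; [lra|]. apply Rinv_le_contravar; lra. }
    replace (/ (l * l) * ((a - b) * (a - b))) with ((b - a) / l * ((b - a) / l)) by (field; lra).
    nra. }
  intros Ha Hb. destruct (Rle_dec a b) as [H|H].
  - now apply W.
  - specialize (W b a Hb ltac:(lra)). lra.
Qed.

(** Converse to the Lipschitz bound, from b - a <= b (ln b - ln a) for a <= b. The factor [a + b] is
    a symmetric substitute for the larger of the two. *)
Lemma sub_le_ln_sub a b : 0 < a -> 0 < b ->
  (a - b) * (a - b) <= (a + b) * (a + b) * ((ln a - ln b) * (ln a - ln b)).
Proof.
  assert (W : forall a b, 0 < a -> a <= b ->
    (a - b) * (a - b) <= (a + b) * (a + b) * ((ln a - ln b) * (ln a - ln b))).
  { clear. intros a b Ha Hab.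
    pose proof (ln_sub_le b a ltac:(lra) Ha) as H1.
    assert (H3 : b - a <= b * (ln b - ln a)).
    { apply (Rmult_le_compat_l b) in H1; [|lra].
      replace (b * ((a - b) / b)) with (a - b) in H1 by (field; lra). lra. }
    assert (H4 : 0 <= ln b - ln a).
    { destruct Hab as [H|H]; [left; apply Rlt_0_minus, ln_increasing; lra | subst; lra]. }
    assert (H5 : b - a <= (a + b) * (ln b - ln a)) by nra.
    replace ((a + b) * (a + b) * ((ln a - ln b) * (ln a - ln b)))
      with (((a + b) * (ln b - ln a)) * ((a + b) * (ln b - ln a))) by ring.
    nra. }
  intros Ha Hb. destruct (Rle_dec a b) as [H|H].
  - now apply W.
  - specialize (W b a Hb ltac:(lra)). lra.
Qed.

Lemma Cnorm2_RtoC_sub a b : Cnorm2 (Csub (RtoC a) (RtoC b)) = (a - b) * (a - b).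
Proof. unfold Cnorm2; cdestr. ring. Qed.

Lemma ip_mconj_diag_same n U a b : unitary n U ->
  ip n (mconj_diag n U (fun i => RtoC (a i))) (mconj_diag n U (fun i => RtoC (b i))) =
  rsum (fun i => a i * b i) n.
Proof.
  intros HU. rewrite ip_mconj_diag by auto. apply rsum_ext; intros i Hi.
  rewrite (rsum_single _ n i); auto.
  - red in HU. rewrite HU by auto. unfold mone. rewrite Nat.eqb_refl.
    unfold Cnorm2, Cone, Cre, Cim; simpl; ring.
  - intros j Hj Hne. red in HU. rewrite HU by auto. unfold mone.
    replace (Nat.eqb i j) with false by (symmetry; apply Nat.eqb_neq; auto).
    unfold Cnorm2, Czero, Cre, Cim; simpl; ring.
Qed.

Lemma mscal_mone c : mscal c mone = mdiag (fun _ => c).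
Proof. mext. unfold mscal, mdiag, mone. destruct (Nat.eqb x x0); ring. Qed.

Lemma mconj_diag_const n U c : unitary n U ->
  meq n (mconj_diag n U (fun _ => c)) (mscal c mone).
Proof.
  intros HU. unfold mconj_diag. rewrite <- mscal_mone.
  assert (E : meq n (mmul n U (mscal c mone)) (mscal c U)).
  { rewrite mscal_mone. intros i j Hi Hj. rewrite mmul_mdiag_r by auto. unfold mscal. ring. }
  rewrite E.
  assert (E2 : mmul n (mscal c U) (madj U) = mscal c (mmul n U (madj U))).
  { mext. unfold mmul, mscal. rewrite <- csum_mul_l. apply csum_ext; intros; ring. }
  rewrite E2, (unitary_adj n U) by auto. reflexivity.
Qed.

Lemma mconj_diag_1 n U : unitary n U ->
  meq n mone (mconj_diag n U (fun i => RtoC 1)).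
Proof.
  intros HU. rewrite mconj_diag_const by auto. intros i j _ _. unfold mscal, mone.
  destruct (Nat.eqb i j); csolve.
Qed.

(** Inserting the identity puts a difference into the form required by [fro_intertwine], even when
    [A] and [B] have different eigenbases. *)
Lemma fro_msub_intertwine n A B : fro n (msub A B) = fro n (msub (mmul n A mone) (mmul n mone B)).
Proof. now rewrite mmul_1_l, mmul_1_r. Qed.

(** Records positivity of the eigenvalues, which [is_log] alone does not imply because [ln] is
    total, with value 0 at nonpositive reals. *)
Definition log_pair (n : nat) (A LA : Mat) : Prop :=
  exists (U : Mat) (a : nat -> R), unitary n U /\ (forall i, (i < n)%nat -> 0 < a i) /\
    meq n A (mconj_diag n U (fun i => RtoC (a i))) /\
    meq n LA (mconj_diag n U (fun i => RtoC (ln (a i)))).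

Lemma qform_mconj n U A i : (i < n)%nat ->
  qform n A (fun k => U k i) = mmul n (madj U) (mmul n A U) i i.
Proof. reflexivity. Qed.

(** The quadratic form of [A] on the i-th column of [U] is the i-th eigenvalue; the column is
    nonzero because the diagonal entries of U^* U are 1. *)
Lemma is_log_pair n A LA : strictly_positive n A -> is_log n A LA -> log_pair n A LA.
Proof.
  intros [_ HA] (U & a & HU & EA & EL). exists U, a. split; [|split; [|split]]; auto.
  intros i Hi. destruct (HA (fun k => U k i)) as [_ Hq].
  - destruct (Classical_Prop.classic (exists k, (k < n)%nat /\ U k i <> Czero)) as [|Hno]; auto.
    exfalso. pose proof (HU i i Hi Hi) as H1. unfold mmul, mone in H1.
    rewrite Nat.eqb_refl, (csum_ext _ (fun _ => Czero)), csum_zero in H1.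
    + unfold Czero, Cone in H1. injection H1. lra.
    + intros k Hk. replace (U k i) with Czero; [ring|].
      apply Classical_Prop.NNPP. intros H. apply Hno. exists k. auto.
  - rewrite qform_mconj in Hq by auto.
    assert (E : meq n (mmul n (madj U) (mmul n A U)) (mdiag (fun i => RtoC (a i)))).
    { rewrite EA, !mmul_assoc. red in HU. rewrite HU, mmul_1_r, <- mmul_assoc, HU, mmul_1_l.
      reflexivity. }
    rewrite E in Hq by auto. unfold mdiag in Hq. rewrite Nat.eqb_refl in Hq.
    unfold RtoC, Cre in Hq; simpl in Hq. lra.
Qed.

Lemma log_pair_scalar n c : 0 < c ->
  log_pair n (mscal (RtoC c) mone) (mscal (RtoC (ln c)) mone).
Proof.
  intros Hc. exists mone, (fun _ => c). repeat split; auto using unitary_mone.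
  - now rewrite mconj_diag_const by apply unitary_mone.
  - now rewrite mconj_diag_const by apply unitary_mone.
Qed.

(** [gibbs] is summed over pairs of eigenvalues with the overlap weights. *)
Lemma klein n A LA B LB : log_pair n A LA -> log_pair n B LB ->
  ip n A LB + ip n mone A - ip n mone B <= ip n A LA.
Proof.
  intros (U & a & HU & Ha & EA & EL) (V & b & HV & Hb & EB & ELB).
  set (W := mmul n (madj U) V).
  assert (E1 : ip n A LB = rsum (fun i => rsum (fun j => a i * ln (b j) * Cnorm2 (W i j)) n) n).
  { rewrite EA, ELB. now apply ip_mconj_diag. }
  (* The identity is diagonal in every basis: it is written in [V] here and in [U] in [E3], so that
     all four terms carry the same weights. *)
  assert (E2 : ip n mone A = rsum (fun i => rsum (fun j => a i * 1 * Cnorm2 (W i j)) n) n).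
  { rewrite ip_sym, EA, (mconj_diag_1 n V) by auto. now apply ip_mconj_diag. }
  assert (E3 : ip n mone B = rsum (fun i => rsum (fun j => 1 * b j * Cnorm2 (W i j)) n) n).
  { rewrite EB, (mconj_diag_1 n U) by auto.
    apply (ip_mconj_diag n U V (fun _ => 1)); auto. }
  assert (E4 : ip n A LA = rsum (fun i => rsum (fun j => a i * ln (a i) * Cnorm2 (W i j)) n) n).
  { rewrite EA, EL, ip_mconj_diag_same by auto. apply rsum_ext; intros i Hi.
    rewrite rsum_scal, (unitary_row n W) by (auto; apply unitary_mul; auto). ring. }
  rewrite E1, E2, E3, E4. unfold Rminus.
  assert (E : forall x y z, x <= y + z -> x + - z <= y) by (intros; lra). apply E.
  rewrite <- !rsum_plus. apply rsum_le; intros i Hi.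
  rewrite <- !rsum_plus. apply rsum_le; intros j Hj.
  pose proof (gibbs (a i) (b j) (Ha i Hi) (Hb j Hj)).
  pose proof (Cnorm2_nonneg (W i j)). nra.
Qed.

(* If some eigenvalue [a i] were below half the least eigenvalue [l] of [B], the row [i]
   of the double sum alone would contribute at least [l^2/4] to [fro (A - B)]. *)
Lemma log_lipschitz n B LB : log_pair n B LB ->
  exists K delta, 0 < K /\ 0 < delta /\ forall A LA, log_pair n A LA ->
    fro n (msub A B) < delta -> fro n (msub LA LB) <= K * fro n (msub A B).
Proof.
  intros (V & b & HV & Hb & EB & ELB).
  destruct (finite_pos_min2 (fun _ j => b j) n (fun _ _ => True)) as (l & Hl & Hlb); auto.
  (* Once all eigenvalues of both matrices are at least [l / 2], [ln] has Lipschitz constant 2/l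
     between them, squared here. *)
  exists (/ (l / 2 * (l / 2))), (l / 2 * (l / 2)).
  assert (Hl2 : 0 < l / 2 * (l / 2)) by nra.
  split; [now apply Rinv_0_lt_compat|]. split; [auto|].
  intros A LA (U & a & HU & Ha & EA & ELA) Hlt.
  rewrite (fro_msub_intertwine n LA), (fro_msub_intertwine n A), EA, EB, ELA, ELB in *.
  apply fro_intertwine_le; auto.
  intros i j Hi Hj. rewrite !Cnorm2_RtoC_sub. apply ln_lipschitz; try lra.
  - destruct (Rle_dec (l / 2) (a i)) as [|Hai]; auto. exfalso.
    rewrite fro_intertwine in Hlt by auto.
    set (W := mmul n (mmul n (madj U) mone) V) in Hlt.
    assert (HW : unitary n W).
    { pose proof (unitary_mul n U V HU HV) as H. unfold W. red in H |- *.
      now rewrite mmul_1_r. }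
    pose proof (rsum_term_le (fun i => rsum (fun j =>
      Cnorm2 (Csub (RtoC (a i)) (RtoC (b j))) * Cnorm2 (W i j)) n) n i) as Hrow.
    simpl in Hrow. specialize (Hrow ltac:(intros; apply rsum_nonneg; intros;
      apply Rmult_le_pos; apply Cnorm2_nonneg) Hi).
    enough (l / 2 * (l / 2) <= rsum (fun j =>
      Cnorm2 (Csub (RtoC (a i)) (RtoC (b j))) * Cnorm2 (W i j)) n) by lra.
    rewrite <- (Rmult_1_r (l / 2 * (l / 2))), <- (unitary_row n W i HW Hi), <- rsum_scal.
    apply rsum_le; intros k Hk. apply Rmult_le_compat_r; [apply Cnorm2_nonneg|].
    rewrite Cnorm2_RtoC_sub. specialize (Hlb i k Hi Hk I). nra.
  - specialize (Hlb i j Hi Hj I). lra.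
Qed.

Lemma log_scalar_inv n A LA c : log_pair n A LA -> meq n LA (mscal (RtoC c) mone) ->
  meq n A (mscal (RtoC (exp c)) mone).
Proof.
  intros (U & a & HU & Ha & EA & ELA) E.
  destruct (finite_bound (fun i =>  (a i + exp c) * (a i + exp c)) n) as (K & HK & HKa).
  apply fro_msub_eq0. apply Rle_antisym; [|apply fro_nonneg].
  (* The right-hand side 0 is replaced by [K] times the squared distance of [LA] to the scalar,
     which vanishes by [E]; the goal then fits [fro_intertwine_le]. *)
  rewrite <- (Rmult_0_r K), <- (proj2 (fro_msub_eq0 n _ _) E), ELA, EA.
  rewrite <- !(mconj_diag_const n mone) by apply unitary_mone.
  rewrite 2(fro_msub_intertwine n (mconj_diag n U _)).
  apply fro_intertwine_le; auto using unitary_mone.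
  intros i j Hi Hj. rewrite !Cnorm2_RtoC_sub.
  pose proof (sub_le_ln_sub (a i) (exp c) (Ha i Hi) (exp_pos c)) as H. rewrite ln_exp in H.
  apply Rle_trans with (1 := H). apply Rmult_le_compat_r; [|auto]. apply Rle_0_sqr.
Qed.

Lemma ip_mone_mone n : ip n mone mone = INR n.
Proof.
  rewrite (mconj_diag_1 n mone) by apply unitary_mone.
  rewrite (ip_mconj_diag_same n mone (fun _ => 1) (fun _ => 1)) by apply unitary_mone.
  rewrite rsum_const. ring.
Qed.

(** Positive eigenvalues with sum 1 are at most 1, so each square is at most the eigenvalue
    itself. *)
Lemma log_pair_fro_le1 n A LA : log_pair n A LA -> ip n mone A = 1 -> fro n A <= 1.
Proof.
  intros (U & a & HU & Ha & EA & _) Htr.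
  assert (E : rsum a n = 1).
  { rewrite <- Htr, EA, (mconj_diag_1 n U) by auto.
    rewrite (ip_mconj_diag_same n U (fun _ => 1)) by auto. apply rsum_ext; intros; ring. }
  unfold fro. rewrite EA, ip_mconj_diag_same by auto. rewrite <- E.
  apply rsum_le; intros i Hi.
  pose proof (rsum_term_le a n i (fun i Hi => Rlt_le _ _ (Ha i Hi)) Hi).
  specialize (Ha i Hi). nra.
Qed.

Lemma fcalc_comm_bound n f x B : is_fcalc n f x B ->
  exists K, 0 < K /\ forall A, fro n (comm n x A) <= K * fro n A.
Proof.
  intros (U & d & HU & Ex & _).
  destruct (finite_bound2 (fun i j => Cnorm2 (Csub (RtoC (d i)) (RtoC (d j)))) n)
    as (K & HK & HKd).
  exists K. split; auto. intros A. unfold comm. rewrite Ex.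
  fold (mconj_diag n U (fun i => RtoC (d i))). rewrite fro_intertwine by auto.
  rewrite <- (fro_unitary_l n U A), <- (fro_unitary_r n U) by auto.
  rewrite fro_sum, <- rsum_scal. apply rsum_le; intros i Hi.
  rewrite <- rsum_scal. apply rsum_le; intros j Hj.
  apply Rmult_le_compat_r; auto using Cnorm2_nonneg.
Qed.

(** * The spectral gap *)

Lemma Cnorm2_add_le a b : Cnorm2 (Cadd a b) <= 2 * Cnorm2 a + 2 * Cnorm2 b.
Proof.
  unfold Cnorm2; cdestr.
  pose proof (Rle_0_sqr (r1 - r)). pose proof (Rle_0_sqr (r2 - r0)). unfold Rsqr in *. lra.
Qed.

Lemma Cexpi_add a b : Cexpi (a + b) = Cmul (Cexpi a) (Cexpi b).
Proof. unfold Cexpi, Cmul; simpl. rewrite cos_plus, sin_plus. f_equal; ring. Qed.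

Lemma Cpow_Cexpi a k : Cpow (Cexpi a) k = Cexpi (INR k * a).
Proof.
  induction k as [|k IH].
  - simpl. rewrite Rmult_0_l. unfold Cexpi, Cone. now rewrite cos_0, sin_0.
  - rewrite S_INR. simpl Cpow. rewrite IH, <- Cexpi_add. f_equal. ring.
Qed.

Lemma Cnorm2_Cexpi_sub a b :
  Cnorm2 (Csub (Cexpi a) (Cexpi b)) = 4 * (sin ((a - b) / 2) * sin ((a - b) / 2)).
Proof.
  assert (E : Cnorm2 (Csub (Cexpi a) (Cexpi b)) = 2 - 2 * cos (a - b)).
  { rewrite cos_minus. unfold Cnorm2, Cexpi, Csub, Cadd, Copp, Cre, Cim; simpl.
    pose proof (sin2_cos2 a). pose proof (sin2_cos2 b). unfold Rsqr in *. lra. }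
  rewrite E. replace (a - b) with (2 * ((a - b) / 2)) at 1 by field.
  rewrite cos_2a_sin. ring.
Qed.

Lemma sin_sqr_le x : sin x * sin x <= x * x.
Proof.
  assert (W : forall x, 0 < x -> sin x * sin x <= x * x).
  { clear. intros x Hx. destruct (Rle_dec 1 x) as [H1|H1].
    - pose proof (sin2_cos2 x). unfold Rsqr in *. pose proof (Rle_0_sqr (cos x)).
      unfold Rsqr in *. nra.
    - pose proof (sin_lt_x x Hx). pose proof PI_RGT_0. pose proof PI2_1.
      assert (0 < sin x) by (apply sin_gt_0; lra). nra. }
  destruct (Rtotal_order x 0) as [H|[->|H]].
  - specialize (W (- x) ltac:(lra)). rewrite sin_neg in W. lra.
  - rewrite sin_0. lra.
  - now apply W.
Qed.

Lemma Cexpi_lipschitz a b : Cnorm2 (Csub (Cexpi a) (Cexpi b)) <= (a - b) * (a - b).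
Proof. rewrite Cnorm2_Cexpi_sub. pose proof (sin_sqr_le ((a - b) / 2)). nra. Qed.

(** [u] is a function of [x] whose Lipschitz constant is |s|, and both are diagonal in the same
    basis. *)
Lemma fro_comm_Cexpi_le n s x u A :
  is_fcalc n (fun r => Cexpi (s * r)) x u ->
  fro n (comm n u A) <= s * s * fro n (comm n x A).
Proof.
  intros (U & d & HU & Ex & Eu). unfold comm. rewrite Ex, Eu.
  apply (fro_intertwine_le n U U); auto.
  intros i j _ _. rewrite Cnorm2_RtoC_sub.
  apply Rle_trans with (1 := Cexpi_lipschitz _ _). right; ring.
Qed.

(** Gauss's lemma: n would divide i - j, although 0 < |i - j| < n. Integers are used because the
    multiple of pi at which a sine vanishes may be negative. *)
Lemma coprime_mul_sub n m i j k : Nat.gcd m n = 1%nat ->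
  (i < n)%nat -> (j < n)%nat -> i <> j ->
  (Z.of_nat m * (Z.of_nat i - Z.of_nat j))%Z <> (k * Z.of_nat n)%Z.
Proof.
  intros Hcop.
  assert (W : forall i j k, (j < i)%nat -> (i < n)%nat ->
    (Z.of_nat m * (Z.of_nat i - Z.of_nat j))%Z <> (k * Z.of_nat n)%Z).
  { clear i j k. intros i j k Hji Hi H.
    assert (Hdiv : Nat.divide n (m * (i - j))).
    { exists (Z.to_nat k). nia. }
    apply Nat.gauss in Hdiv; [|now rewrite Nat.gcd_comm].
    apply Nat.divide_pos_le in Hdiv; lia. }
  intros Hi Hj Hij H. assert (i < j \/ j < i)%nat as [Hlt|Hlt] by lia.
  - apply (W j i (- k)%Z Hlt Hj). lia.
  - exact (W i j k Hlt Hi H).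
Qed.

Lemma qroot_pow_sub_pos n m i j : (1 <= n)%nat -> Nat.gcd m n = 1%nat ->
  (i < n)%nat -> (j < n)%nat -> i <> j ->
  0 < Cnorm2 (Csub (Cpow (qroot n m) i) (Cpow (qroot n m) j)).
Proof.
  intros Hn Hcop Hi Hj Hij. unfold qroot. rewrite !Cpow_Cexpi, Cnorm2_Cexpi_sub.
  set (th := _ / 2).
  assert (Hs : sin th <> 0).
  { intros Hs. apply sin_eq_0_0 in Hs. destruct Hs as [k Hk]. unfold th in Hk.
    assert (Hn0 : INR n <> 0) by (apply not_0_INR; lia).
    assert (HZ : IZR (Z.of_nat m * (Z.of_nat i - Z.of_nat j)) = IZR (k * Z.of_nat n)).
    { rewrite !mult_IZR, minus_IZR, <- !INR_IZR_INZ.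
      pose proof PI_RGT_0 as HPI.
      apply Rmult_eq_reg_r with PI; [|lra].
      replace (IZR k * INR n * PI) with (IZR k * PI * INR n) by ring.
      rewrite <- Hk. field. auto. }
    apply eq_IZR in HZ.
    exact (coprime_mul_sub n m i j k Hcop Hi Hj Hij HZ). }
  assert (0 < sin th * sin th) by (apply Rsqr_pos_lt in Hs; exact Hs). lra.
Qed.

(** * Commutators with the clock and shift matrices *)

Lemma comm_umat_entry n m A i j : (i < n)%nat -> (j < n)%nat ->
  comm n (umat n m) A i j =
  Cmul (Csub (Cpow (qroot n m) i) (Cpow (qroot n m) j)) (A i j).
Proof.
  intros Hi Hj. unfold comm, umat. unfold msub, madd, mopp.
  rewrite mmul_mdiag_l, mmul_mdiag_r by auto. ring.
Qed.

(** For S i < n, row i and column S i of [vmat n] have a single nonzero entry, so the wrap-around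
    corner does not enter. *)
Lemma comm_vmat_entry n A i : (S i < n)%nat ->
  comm n (vmat n) A i (S i) = Csub (A (S i) (S i)) (A i i).
Proof.
  intros Hi. unfold comm, msub, madd, mopp, mmul.
  rewrite (csum_single _ n (S i)), (csum_single _ n i); try lia.
  - unfold vmat. rewrite Nat.eqb_refl. ring.
  - intros k Hk Hne. unfold vmat.
    replace (Nat.eqb (S i) (S k)) with false by (symmetry; apply Nat.eqb_neq; lia).
    replace (Nat.eqb (S i) 0) with false by reflexivity.
    rewrite Bool.andb_false_r. ring.
  - intros k Hk Hne. unfold vmat.
    replace (Nat.eqb k (S i)) with false by (symmetry; apply Nat.eqb_neq; lia).
    replace (Nat.eqb i (n - 1)) with false by (symmetry; apply Nat.eqb_neq; lia).
    simpl. ring.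
Qed.

(** Consecutive diagonal entries differ by an entry of the commutator. Each step of the chain at
    most doubles the squared error and adds 2, and 2 + 2 * 4^i <= 4^(i+1). *)
Lemma diag_variation n A i : (i < n)%nat ->
  Cnorm2 (Csub (A i i) (A 0%nat 0%nat)) <= 4 ^ i * fro n (comm n (vmat n) A).
Proof.
  induction i as [|i IH]; intros Hi.
  - replace (Csub (A 0%nat 0%nat) (A 0%nat 0%nat)) with Czero by ring.
    pose proof (fro_nonneg n (comm n (vmat n) A)). unfold Cnorm2, Czero, Cre, Cim; simpl. lra.
  - specialize (IH ltac:(lia)).
    replace (Csub (A (S i) (S i)) (A 0%nat 0%nat))
      with (Cadd (Csub (A (S i) (S i)) (A i i)) (Csub (A i i) (A 0%nat 0%nat))) by ring.
    pose proof (Cnorm2_add_le (Csub (A (S i) (S i)) (A i i)) (Csub (A i i) (A 0%nat 0%nat))).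
    pose proof (fro_entry n (comm n (vmat n) A) i (S i) ltac:(lia) Hi) as H1.
    rewrite comm_vmat_entry in H1 by auto.
    pose proof (fro_nonneg n (comm n (vmat n) A)).
    assert (1 <= 4 ^ i) by (apply pow_R1_Rle; lra). simpl. nra.
Qed.

(* [u] controls the off-diagonal entries and [v] the variation along the diagonal. *)
Lemma spectral_gap n m x y : (1 <= n)%nat -> Nat.gcd m n = 1%nat ->
  is_fcalc n (fun r => Cexpi (2 * PI * r / INR n)) x (umat n m) ->
  is_fcalc n (fun r => Cexpi (2 * PI * r / INR n)) y (vmat n) ->
  exists K, 0 < K /\ forall A,
    fro n (msub A (mscal (A 0%nat 0%nat) mone)) <=
    K * (fro n (comm n x A) + fro n (comm n y A)).
Proof.
  intros Hn Hcop Hx Hy. set (s := 2 * PI / INR n).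
  assert (Es : (fun r => Cexpi (2 * PI * r / INR n)) = (fun r => Cexpi (s * r))).
  { apply functional_extensionality; intros r. f_equal. unfold s. field.
    apply not_0_INR. lia. }
  rewrite Es in Hx, Hy.
  destruct (finite_pos_min2
    (fun i j => Cnorm2 (Csub (Cpow (qroot n m) i) (Cpow (qroot n m) j))) n
    (fun i j => i <> j)) as (mu & Hmu & Hmin).
  { intros; now apply qroot_pow_sub_pos. }
  assert (H4 : 1 <= 4 ^ n) by (apply pow_R1_Rle; lra).
  assert (Himu : 0 < / mu) by now apply Rinv_0_lt_compat.
  (* [/ mu] serves the off-diagonal entries, [4 ^ n] the diagonal ones, and [s * s] the passage from
     [u], [v] to [x], [y]. Summing this entrywise bound costs a further factor n^2. *)
  set (K := (/ mu + 4 ^ n) * (s * s + 1)).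
  assert (HK : 0 < K) by (unfold K; apply Rmult_lt_0_compat; nra).
  assert (Hentry : forall A i j, (i < n)%nat -> (j < n)%nat ->
    Cnorm2 (msub A (mscal (A 0%nat 0%nat) mone) i j) <=
    K * (fro n (comm n x A) + fro n (comm n y A))).
  { intros A i j Hi Hj.
    pose proof (fro_comm_Cexpi_le n s x _ A Hx) as Hu.
    pose proof (fro_comm_Cexpi_le n s y _ A Hy) as Hv.
    pose proof (fro_nonneg n (comm n x A)) as Px. pose proof (fro_nonneg n (comm n y A)) as Py.
    pose proof (fro_nonneg n (comm n (umat n m) A)) as Pu.
    pose proof (fro_nonneg n (comm n (vmat n) A)) as Pv.
    apply Rle_trans with
      ((/ mu + 4 ^ n) * (fro n (comm n (umat n m) A) + fro n (comm n (vmat n) A))).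
    2: { unfold K. rewrite Rmult_assoc. apply Rmult_le_compat_l; [lra|]. nra. }
    unfold msub, madd, mopp, mscal, mone. destruct (Nat.eqb_spec i j) as [<-|Hij].
    - pose proof (diag_variation n A i Hi) as Hd.
      replace (Cadd (A i i) (Copp (Cmul (A 0%nat 0%nat) Cone)))
        with (Csub (A i i) (A 0%nat 0%nat)) by ring.
      assert (4 ^ i <= 4 ^ n) by (apply Rle_pow; [lra|lia]). nra.
    - replace (Cadd (A i j) (Copp (Cmul (A 0%nat 0%nat) Czero))) with (A i j) by ring.
      pose proof (fro_entry n (comm n (umat n m) A) i j Hi Hj) as H1.
      rewrite comm_umat_entry, Cnorm2_mul in H1 by auto.
      specialize (Hmin i j Hi Hj Hij). pose proof (Cnorm2_nonneg (A i j)) as H2.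
      assert (H3 : mu * Cnorm2 (A i j) <= fro n (comm n (umat n m) A)) by nra.
      apply (Rmult_le_compat_l (/ mu)) in H3; [|lra].
      rewrite <- Rmult_assoc, Rinv_l, Rmult_1_l in H3 by lra. nra. }
  exists (INR n * (INR n * K)). split.
  - assert (0 < INR n) by (apply lt_0_INR; lia). apply Rmult_lt_0_compat; [auto|nra].
  - intros A. rewrite fro_sum, !Rmult_assoc, <- rsum_const. apply rsum_le; intros i Hi.
    rewrite <- rsum_const. apply rsum_le; auto.
Qed.

(** * Derivatives on a half-line *)

(** One-sided at [t0] and two-sided beyond it; [D_in] supplies the sum and product rules on such a
    domain. *)
Definition der (t0 : R) (f : R -> R) (t l : R) : Prop :=
  D_in f (fun _ => l) (fun s => t0 <= s) t.

Lemma der_eps t0 f t l : der t0 f t l <->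
  forall eps, 0 < eps -> exists d, 0 < d /\ forall s, t0 <= s -> s <> t -> Rabs (s - t) < d ->
    Rabs ((f s - f t) / (s - t) - l) < eps.
Proof.
  unfold der, D_in, limit1_in, limit_in, D_x, Rdist; simpl. unfold Rdist.
  split; intros H eps He; destruct (H eps He) as (d & Hd & Hl); exists d; split; auto.
  intros s [[Hs Hne] Hlt]. auto.
Qed.

Lemma der_ext t0 f g t l : t0 <= t -> (forall s, t0 <= s -> f s = g s) ->
  der t0 f t l -> der t0 g t l.
Proof.
  rewrite !der_eps. intros Ht E H eps He. destruct (H eps He) as (d & Hd & Hl).
  exists d. split; auto. intros s Hs Hne Hlt. rewrite <- !E by auto. auto.
Qed.

Lemma der_const t0 c t : der t0 (fun _ => c) t 0.
Proof. apply Dconst. Qed.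

Lemma der_plus t0 f g t a b : der t0 f t a -> der t0 g t b ->
  der t0 (fun s => f s + g s) t (a + b).
Proof. intros Hf Hg. exact (Dadd _ _ _ _ _ _ Hf Hg). Qed.

Lemma der_mult t0 f g t a b : der t0 f t a -> der t0 g t b ->
  der t0 (fun s => f s * g s) t (a * g t + f t * b).
Proof. intros Hf Hg. exact (Dmult _ _ _ _ _ _ Hf Hg). Qed.

Lemma der_rsum t0 (f : nat -> R -> R) (l : nat -> R) t n :
  (forall i, (i < n)%nat -> der t0 (f i) t (l i)) ->
  der t0 (fun s => rsum (fun i => f i s) n) t (rsum l n).
Proof.
  induction n as [|n IH]; intros H; simpl.
  - apply der_const.
  - apply der_plus; auto.
Qed.

Lemma derivable_der t0 f t l : derivable_pt_lim f t l -> der t0 f t l.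
Proof.
  rewrite der_eps. intros H eps He. destruct (H eps He) as (d & Hd).
  exists d. split; [apply cond_pos|]. intros s _ Hne Hlt.
  specialize (Hd (s - t) ltac:(lra) Hlt). now replace (t + (s - t)) with s in Hd by ring.
Qed.

Lemma der_exp t0 c t : der t0 (fun s => exp (c * s)) t (c * exp (c * t)).
Proof.
  apply derivable_der.
  replace (c * exp (c * t)) with (exp (c * t) * (c * 1)) by ring.
  apply (derivable_pt_lim_comp (fun s => c * s) exp).
  - apply derivable_pt_lim_scal, derivable_pt_lim_id.
  - apply derivable_pt_lim_exp.
Qed.

Lemma der_continuous t0 f t l : der t0 f t l -> forall eps, 0 < eps ->
  exists d, 0 < d /\ forall s, t0 <= s -> Rabs (s - t) < d -> Rabs (f s - f t) < eps.
Proof.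
  intros H eps He. pose proof (cont_deriv _ _ _ _ H) as Hc.
  destruct (Hc eps He) as (d & Hd & Hl). exists d. split; auto.
  intros s Hs Hlt. destruct (Req_dec t s) as [->|Hne].
  - rewrite Rminus_diag, Rabs_R0. auto.
  - apply Hl. repeat split; auto.
Qed.

(* Extending [f] affinely to the left of [t0] reduces this to the two-sided theorem. *)
Lemma der_MVT t0 f f' a b : (forall t, t0 <= t -> der t0 f t (f' t)) -> t0 <= a -> a < b ->
  exists c, a < c < b /\ f b - f a = f' c * (b - a).
Proof.
  intros H Ha Hab.
  set (g := fun s => if Rlt_dec s t0 then f t0 + f' t0 * (s - t0) else f s).
  assert (Eg : forall s, t0 <= s -> g s = f s).
  { intros s Hs. unfold g. destruct (Rlt_dec s t0); [lra|auto]. }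
  destruct (MVT_cor2 g f' a b Hab) as (c & E & Hc).
  - intros t Ht eps He. destruct (proj1 (der_eps _ _ _ _) (H t ltac:(lra)) eps He) as (d & Hd & Hl).
    (* For t > t0 the radius is cut to stay right of [t0]. Hence the affine branch is met only at t
       = t0, where its difference quotient is exactly [f' t0]. *)
    assert (Hd' : 0 < if Rlt_dec t0 t then Rmin d (t - t0) else d).
    { destruct (Rlt_dec t0 t); auto. apply Rmin_pos; lra. }
    exists (mkposreal _ Hd'). simpl. intros h Hh Hlt.
    rewrite (Eg t) by lra. unfold g. destruct (Rlt_dec (t + h) t0) as [Hth|Hth].
    + assert (t = t0) as ->.
      { destruct (Rlt_dec t0 t); [|lra]. exfalso. pose proof (Rmin_r d (t - t0)).
        apply Rabs_def2 in Hlt. lra. }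
      replace ((f t0 + f' t0 * (t0 + h - t0) - f t0) / h - f' t0) with 0 by (field; auto).
      rewrite Rabs_R0; auto.
    + specialize (Hl (t + h) ltac:(lra) ltac:(lra)).
      replace (t + h - t) with h in Hl by ring. apply Hl.
      destruct (Rlt_dec t0 t); auto. pose proof (Rmin_l d (t - t0)). lra.
  - exists c. rewrite !Eg in E by lra. auto.
Qed.

(** The increments of F - G are dominated by those of [Q], which are o(s - t). In the application
    [G] linearizes [F] and [Q] is a squared distance. *)
Lemma der_squeeze t0 F G Q t g C d : t0 <= t -> der t0 G t g -> der t0 Q t 0 -> 0 < d -> 0 < C ->
  (forall s, t0 <= s -> Rabs (s - t) < d ->
     Rabs (F s - F t - (G s - G t)) <= C * Rabs (Q s - Q t)) ->
  der t0 F t g.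
Proof.
  intros Ht HG HQ Hd HC H.
  assert (HE : der t0 (fun s => F s - F t - (G s - G t)) t 0).
  { apply der_eps. intros eps He. destruct (proj1 (der_eps _ _ _ _) HQ (eps / C)) as (d1 & Hd1 & H1).
    { now apply Rdiv_lt_0_compat. }
    exists (Rmin d d1). split; [now apply Rmin_pos|]. intros s Hs Hne Hlt.
    pose proof (Rmin_l d d1). pose proof (Rmin_r d d1).
    specialize (H s Hs ltac:(lra)). specialize (H1 s Hs Hne ltac:(lra)).
    rewrite Rminus_0_r in H1 |- *. rewrite !Rminus_diag, !Rminus_0_r.
    unfold Rdiv in *. rewrite Rabs_mult in *.
    assert (Hp : 0 < Rabs (/ (s - t))) by (apply Rabs_pos_lt, Rinv_neq_0_compat; lra).
    apply Rle_lt_trans with (C * (Rabs (Q s - Q t) * Rabs (/ (s - t)))); [nra|].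
    apply (Rmult_lt_compat_l C) in H1; auto.
    replace (C * (eps * / C)) with eps in H1 by (field; lra). auto. }
  apply der_ext with (f := fun s => (F s - F t - (G s - G t)) + (G s + (F t - G t))); auto.
  - intros; ring.
  - replace g with (0 + (g + 0)) by ring. repeat apply der_plus; auto using der_const.
Qed.

Lemma gronwall_zero t0 r r' s C d :
  (forall t, t0 <= t -> der t0 r t (r' t)) -> (forall t, 0 <= r t) -> t0 <= s -> r s = 0 ->
  (forall t, t0 <= t -> Rabs (t - s) < d -> Rabs (r' t) <= C * r t) ->
  forall t, t0 <= t -> Rabs (t - s) < d -> r t = 0.
Proof.
  (* Integrating factors work in both time directions: r exp(C t) is nondecreasing before [s] and r
     exp(- C t) nonincreasing after it, while both vanish at [s]. The backward direction is what
     rules out arrival at the fixed point. *)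
  intros Hder Hpos Hs Hrs Hb t Ht Hts.
  assert (HD : forall c t, t0 <= t ->
    der t0 (fun t => r t * exp (c * t)) t (r' t * exp (c * t) + r t * (c * exp (c * t)))).
  { intros c u Hu. apply (der_mult t0 r (fun t => exp (c * t))); auto. apply der_exp. }
  apply Rle_antisym; [|auto].
  destruct (Rtotal_order t s) as [H|[->|H]]; [| lra |].
  - destruct (der_MVT _ _ _ t s (HD C) Ht H) as (c & Hc & E). rewrite Hrs in E.
    specialize (Hb c ltac:(lra) ltac:(apply Rabs_def2 in Hts; apply Rabs_def1; lra)).
    pose proof (exp_pos (C * c)). pose proof (exp_pos (C * t)).
    pose proof (Rle_abs (- r' c)) as Ha. rewrite Rabs_Ropp in Ha.
    assert (0 <= (r' c + C * r c) * exp (C * c) * (s - t)).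
    { apply Rmult_le_pos; [|lra]. apply Rmult_le_pos; lra. }
    assert (r t * exp (C * t) <= 0) by lra. nra.
  - destruct (der_MVT _ _ _ s t (HD (- C)) Hs H) as (c & Hc & E). rewrite Hrs in E.
    specialize (Hb c ltac:(lra) ltac:(apply Rabs_def2 in Hts; apply Rabs_def1; lra)).
    pose proof (exp_pos (- C * c)). pose proof (exp_pos (- C * t)).
    pose proof (Rle_abs (r' c)) as Ha.
    assert (0 <= (C * r c - r' c) * exp (- C * c) * (t - s)).
    { apply Rmult_le_pos; [|lra]. apply Rmult_le_pos; lra. }
    assert (r t * exp (- C * t) <= 0) by lra. nra.
Qed.

(* The indicator function of the zero set is locally constant. *)
Lemma zero_everywhere t0 r r' s :
  (forall t, t0 <= t -> der t0 r t (r' t)) -> (forall t, 0 <= r t) -> t0 <= s -> r s = 0 ->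
  (forall s, t0 <= s -> r s = 0 -> exists C d, 0 < d /\
     forall t, t0 <= t -> Rabs (t - s) < d -> Rabs (r' t) <= C * r t) ->
  forall t, t0 <= t -> r t = 0.
Proof.
  intros Hder Hpos Hs Hrs Hb.
  set (chi := fun t => if Req_EM_T (r t) 0 then 1 else 0).
  assert (Hloc : forall t, t0 <= t -> exists d, 0 < d /\
    forall u, t0 <= u -> Rabs (u - t) < d -> chi u = chi t).
  { intros t Ht. unfold chi. destruct (Req_EM_T (r t) 0) as [Hz|Hz].
    - destruct (Hb t Ht Hz) as (C & d & Hd & H). exists d. split; auto.
      intros u Hu Hut. destruct (Req_EM_T (r u) 0) as [|Hn]; auto. exfalso; apply Hn.
      exact (gronwall_zero t0 r r' t C d Hder Hpos Ht Hz H u Hu Hut).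
    - destruct (der_continuous _ _ _ _ (Hder t Ht) (r t)) as (d & Hd & H).
      { specialize (Hpos t). lra. }
      exists d. split; auto. intros u Hu Hut. specialize (H u Hu Hut).
      destruct (Req_EM_T (r u) 0) as [E|]; auto. rewrite E in H.
      apply Rabs_def2 in H. lra. }
  (* Connectedness of the half-line is obtained from the mean value theorem: a locally constant
     function has derivative 0. *)
  assert (Hchi : forall t, t0 <= t -> der t0 chi t ((fun _ => 0) t)).
  { intros t Ht. apply der_eps. intros eps He. destruct (Hloc t Ht) as (d & Hd & H).
    exists d. split; auto. intros u Hu Hne Hut. rewrite H by auto.
    rewrite Rminus_diag. unfold Rdiv. rewrite Rmult_0_l, Rminus_0_r, Rabs_R0. auto. }
  assert (Hconst : forall t, t0 <= t -> chi t = chi s).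
  { intros t Ht. destruct (Rtotal_order t s) as [H|[->|H]]; auto.
    - destruct (der_MVT _ _ _ t s Hchi Ht H) as (c & _ & E). lra.
    - destruct (der_MVT _ _ _ s t Hchi Hs H) as (c & _ & E). lra. }
  intros t Ht. specialize (Hconst t Ht). unfold chi in Hconst.
  destruct (Req_EM_T (r t) 0); auto. destruct (Req_EM_T (r s) 0); lra.
Qed.

(** * Matrix-valued functions of time *)

Definition mder (n : nat) (t0 : R) (A : R -> Mat) (t : R) (A' : Mat) : Prop :=
  forall i j, (i < n)%nat -> (j < n)%nat ->
    der t0 (fun s => Cre (A s i j)) t (Cre (A' i j)) /\
    der t0 (fun s => Cim (A s i j)) t (Cim (A' i j)).

Lemma Rabs_le_Cmod z : Rabs (Cre z) <= Cmod z /\ Rabs (Cim z) <= Cmod z.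
Proof.
  unfold Cmod, Cre, Cim. destruct z as [a b]; simpl.
  rewrite <- (sqrt_Rsqr_abs a), <- (sqrt_Rsqr_abs b). unfold Rsqr.
  split; apply sqrt_le_1_alt; nra.
Qed.

Lemma mderiv_on_mder n t0 rho t D : mderiv_on n t0 rho t D -> mder n t0 rho t D.
Proof.
  intros H i j Hi Hj. split; apply der_eps; intros eps He;
  destruct (H i j Hi Hj eps He) as (d & Hd & Hl); exists d; (split; [lra|]);
  intros s Hs Hne Hlt; specialize (Hl (s - t) ltac:(lra) Hlt ltac:(lra));
  replace (t + (s - t)) with s in Hl by ring;
  match type of Hl with Cmod ?z < _ => pose proof (Rabs_le_Cmod z) as [Hr Hc] end.
  - eapply Rle_lt_trans; [|exact Hl]. eapply Rle_trans; [|exact Hr]. right. f_equal.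
    unfold mscal, msub, madd, mopp, Csub, Cadd, Copp, Cmul, RtoC, Cre; simpl. unfold Rdiv; ring.
  - eapply Rle_lt_trans; [|exact Hl]. eapply Rle_trans; [|exact Hc]. right. f_equal.
    unfold mscal, msub, madd, mopp, Csub, Cadd, Copp, Cmul, RtoC, Cim; simpl. unfold Rdiv; ring.
Qed.

Lemma mder_const n t0 A t : mder n t0 (fun _ => A) t mzero.
Proof. intros i j _ _. split; apply der_const. Qed.

Lemma der_ip n t0 A B t A' B' : mder n t0 A t A' -> mder n t0 B t B' ->
  der t0 (fun s => ip n (A s) (B s)) t (ip n A' (B t) + ip n (A t) B').
Proof.
  intros HA HB. unfold ip. rewrite <- rsum_plus.
  apply (der_rsum t0 (fun i s => rsum (fun j => _) n)). intros i Hi.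
  rewrite <- rsum_plus. apply (der_rsum t0 (fun j s => _)). intros j Hj.
  destruct (HA i j Hi Hj) as [Ar Ai]. destruct (HB i j Hi Hj) as [Br Bi].
  match goal with |- der _ _ _ ?l => replace l with
    ((Cre (A' i j) * Cre (B t i j) + Cre (A t i j) * Cre (B' i j)) +
     (Cim (A' i j) * Cim (B t i j) + Cim (A t i j) * Cim (B' i j))) by ring end.
  apply der_plus; apply der_mult; auto.
Qed.

Lemma ip_mzero_r n A : ip n A mzero = 0.
Proof.
  unfold ip. rewrite (rsum_ext _ (fun _ => 0)), rsum_const; [ring|].
  intros. rewrite (rsum_ext _ (fun _ => 0)), rsum_const; [ring|].
  intros. unfold mzero, Cre, Cim; simpl; ring.
Qed.

Lemma der_ip_const n t0 A t A' B : mder n t0 A t A' ->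
  der t0 (fun s => ip n (A s) B) t (ip n A' B).
Proof.
  intros HA. pose proof (der_ip n t0 A (fun _ => B) t A' mzero HA (mder_const _ _ _ _)) as H.
  simpl in H. now rewrite ip_mzero_r, Rplus_0_r in H.
Qed.

Lemma der_fro_msub n t0 A t A' B : t0 <= t -> mder n t0 A t A' ->
  der t0 (fun s => fro n (msub (A s) B)) t (2 * ip n A' (msub (A t) B)).
Proof.
  intros Ht HA.
  apply der_ext with (f := fun s => ip n (A s) (A s) + (-2 * ip n (A s) B + ip n B B)); auto.
  - intros s _. unfold fro. rewrite ip_msub_l, !ip_msub_r, (ip_sym n B (A s)). ring.
  - rewrite ip_msub_r.
    replace (2 * (ip n A' (A t) - ip n A' B)) with
      ((ip n A' (A t) + ip n (A t) A') + ((0 * ip n (A t) B + -2 * ip n A' B) + 0))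
      by (rewrite (ip_sym n (A t) A'); ring).
    apply der_plus; [now apply der_ip|]. apply der_plus; [|apply der_const].
    apply (der_mult t0 (fun _ => -2)); [apply der_const|now apply der_ip_const].
Qed.

(* By Klein's inequality, [F s - F t] lies between [ip (rho s - rho t) (L t)] and
   [ip (rho s - rho t) (L s)], which differ by a term of second order. *)
Lemma der_tr_log n t0 rho L t D : t0 <= t ->
  (forall s, t0 <= s -> log_pair n (rho s) (L s)) ->
  (forall s, t0 <= s -> ip n mone (rho s) = 1) ->
  mder n t0 rho t D ->
  der t0 (fun s => ip n (rho s) (L s)) t (ip n D (L t)).
Proof.
  intros Ht Hlog Htr HD.
  destruct (log_lipschitz n _ _ (Hlog t Ht)) as (K & d & HK & Hd & HL).
  pose proof (der_fro_msub n t0 rho t D (rho t) Ht HD) as HQ.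
  assert (E0 : fro n (msub (rho t) (rho t)) = 0) by (apply fro_msub_eq0; reflexivity).
  rewrite (proj2 (meq_msub0 n (rho t) (rho t))), ip_mzero_r, Rmult_0_r in HQ by reflexivity.
  destruct (der_continuous _ _ _ _ HQ d Hd) as (d1 & Hd1 & Hc).
  (* The two Klein bounds differ by <rho s - rho t, L s - L t>. AM-GM and the local Lipschitz bound
     make twice this at most (1 + K) times [Q]; [Q] has derivative 0 at [t], being a square that
     vanishes there. *)
  apply der_squeeze with (G := fun s => ip n (rho s) (L t))
    (Q := fun s => fro n (msub (rho s) (rho t))) (C := 1 + K) (d := d1);
    auto using der_ip_const; [lra|].
  intros s Hs Hlt. specialize (Hc s Hs Hlt). rewrite E0, Rminus_0_r in Hc |- *.
  pose proof (fro_nonneg n (msub (rho s) (rho t))) as Hq.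
  rewrite Rabs_pos_eq in Hc by auto. rewrite (Rabs_pos_eq (fro _ _)) by auto.
  specialize (HL _ _ (Hlog s Hs) Hc).
  pose proof (klein n _ _ _ _ (Hlog s Hs) (Hlog t Ht)) as K1.
  pose proof (klein n _ _ _ _ (Hlog t Ht) (Hlog s Hs)) as K2.
  rewrite !Htr in K1, K2 by auto.
  pose proof (ip_le_fro n 1 (msub (rho s) (rho t)) (msub (L s) (L t)) ltac:(lra)) as H.
  rewrite ip_msub_l, !ip_msub_r in H.
  apply Rabs_le. nra.
Qed.

(** * The flow *)

Lemma log_pair_hermitian n A LA : log_pair n A LA -> hermitian n LA.
Proof.
  intros (U & a & HU & _ & _ & E). red. rewrite E. unfold mconj_diag.
  rewrite !madj_mmul, madj_invol, mmul_assoc.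
  replace (madj (mdiag (fun i => RtoC (ln (a i))))) with (mdiag (fun i => RtoC (ln (a i)))).
  - reflexivity.
  - mext. unfold madj, mdiag. rewrite Nat.eqb_sym. destruct (Nat.eqb_spec x0 x) as [->|]; csolve.
Qed.

Lemma ip_mone_comm n y A : hermitian n y -> ip n (comm n y A) mone = 0.
Proof.
  intros Hy. rewrite ip_comm by auto.
  rewrite <- (ip_mzero_r n A). apply ip_proper; [reflexivity|].
  unfold comm. rewrite meq_msub0, mmul_1_l, mmul_1_r. reflexivity.
Qed.

Lemma ip_mone_lap n x y A : hermitian n x -> hermitian n y -> ip n (lap n x y A) mone = 0.
Proof.
  intros Hx Hy. unfold lap, delta1, delta2.
  rewrite ip_madd_l, ip_mopp_l, !ip_mone_comm by auto. ring.
Qed.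

Lemma fro_lap_bound n f x y u v : is_fcalc n f x u -> is_fcalc n f y v ->
  exists K, 0 < K /\ forall A, fro n (lap n x y A) <= K * fro n A.
Proof.
  intros Hx Hy. destruct (fcalc_comm_bound _ _ _ _ Hx) as (K1 & HK1 & H1).
  destruct (fcalc_comm_bound _ _ _ _ Hy) as (K2 & HK2 & H2).
  exists (2 * (K2 * K2) + 2 * (K1 * K1)). split; [nra|]. intros A.
  unfold lap, delta1, delta2.
  apply Rle_trans with (1 := fro_madd_le _ _ _). rewrite fro_mopp.
  pose proof (H2 (comm n y A)). pose proof (H2 A).
  pose proof (H1 (mopp (comm n x A))) as H3. rewrite fro_mopp in H3. pose proof (H1 A). nra.
Qed.

(** Scalars lie in the kernel, so the velocity of the flow is controlled by the distance of [L] to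
    the logarithm of 1/n. *)
Lemma lap_msub_scalar n x y A c :
  meq n (lap n x y (msub A (mscal c mone))) (lap n x y A).
Proof.
  assert (E : forall z, meq n (comm n z (msub A (mscal c mone))) (comm n z A)).
  { intros z. rewrite comm_msub, comm_scalar. intros i j _ _.
    unfold msub, madd, mopp, mzero. ring. }
  unfold lap, delta1, delta2. now rewrite !E.
Qed.

(* If [1/n] is reached at time [s], then near [s] the logarithm is Lipschitz, so
   [r = fro (rho - 1/n)] satisfies a linear differential inequality. *)
Lemma flow_uniform n f x y u v t0 rho L s :
  (1 <= n)%nat -> is_fcalc n f x u -> is_fcalc n f y v ->
  (forall t, t0 <= t -> log_pair n (rho t) (L t)) ->
  (forall t, t0 <= t -> mder n t0 rho t (mopp (lap n x y (L t)))) ->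
  t0 <= s -> meq n (rho s) (mscal (RtoC (/ INR n)) mone) ->
  forall t, t0 <= t -> meq n (rho t) (mscal (RtoC (/ INR n)) mone).
Proof.
  intros Hn Hx Hy Hlog Hflow Hs Es t Ht.
  set (B := mscal (RtoC (/ INR n)) mone) in *.
  assert (Hn0 : 0 < / INR n) by (apply Rinv_0_lt_compat, lt_0_INR; lia).
  destruct (fro_lap_bound _ _ _ _ _ _ Hx Hy) as (M & HM & Hlap).
  destruct (log_lipschitz n _ _ (log_pair_scalar n _ Hn0)) as (K & d & HK & Hd & HL).
  apply fro_msub_eq0.
  apply (zero_everywhere t0 (fun t => fro n (msub (rho t) B))
    (fun t => 2 * ip n (mopp (lap n x y (L t))) (msub (rho t) B)) s);
    auto using fro_nonneg, der_fro_msub.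
  - now apply fro_msub_eq0.
  - intros s' Hs' Ez.
    destruct (der_continuous _ _ _ _ (der_fro_msub n t0 rho s' _ B Hs' (Hflow s' Hs')) d Hd)
      as (d1 & Hd1 & Hc).
    (* By AM-GM, |2 <lap L, rho - B>| <= ||lap L||^2 + r, and the first term is at most M K r. *)
    exists (1 + M * K), d1. split; auto. intros w Hw Hlt. specialize (Hc w Hw Hlt).
    cbv beta in Hc. rewrite Ez, Rminus_0_r, Rabs_pos_eq in Hc by apply fro_nonneg.
    specialize (HL _ _ (Hlog w Hw) Hc). fold B in HL.
    pose proof (Hlap (msub (L w) (mscal (RtoC (ln (/ INR n))) mone))) as H.
    rewrite lap_msub_scalar in H.
    pose proof (ip_le_fro n 1 (lap n x y (L w)) (msub (rho w) B) ltac:(lra)) as I1.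
    pose proof (ip_le_fro n 1 (mopp (lap n x y (L w))) (msub (rho w) B) ltac:(lra)) as I2.
    rewrite fro_mopp in I2. rewrite ip_mopp_l in I2 |- *.
    apply Rabs_le. nra.
Qed.

(** Klein's inequality is used twice, with the roles of [A] and 1/n exchanged. Since A - 1/n has
    trace 0, any real scalar [c] may be subtracted from [LA]; AM-GM with weight [eps] and ||A -
    1/n||^2 <= 1 then give the second bound. *)
Lemma entropy_gap_bounds n A LA c : (1 <= n)%nat -> log_pair n A LA -> ip n mone A = 1 ->
  0 <= ip n A LA + ln (INR n) /\
  forall eps, 0 < eps -> 2 * (ip n A LA + ln (INR n)) <=
    eps + fro n (msub LA (mscal (RtoC c) mone)) / eps.
Proof.
  intros Hn HA Htr.
  assert (HN : 0 < INR n) by (apply lt_0_INR; lia).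
  assert (Hn0 : 0 < / INR n) by now apply Rinv_0_lt_compat.
  pose proof (log_pair_scalar n _ Hn0) as HB. rewrite ln_Rinv in HB by auto.
  set (B := mscal (RtoC (/ INR n)) mone) in *.
  assert (HtrB : ip n mone B = 1).
  { unfold B. rewrite ip_mscal_r, ip_mone_mone. field. lra. }
  pose proof (klein n _ _ _ _ HA HB) as K1. pose proof (klein n _ _ _ _ HB HA) as K2.
  rewrite Htr, HtrB, ip_mscal_r in K1, K2.
  rewrite (ip_sym n A mone), Htr in K1. rewrite (ip_sym n B mone), HtrB in K2.
  split; [lra|]. intros eps He.
  pose proof (ip_le_fro n eps (msub A B) (msub LA (mscal (RtoC c) mone)) He) as H.
  rewrite ip_msub_r, ip_mscal_r, 2(ip_msub_l n A B) in H.
  rewrite (ip_sym n A mone), (ip_sym n B mone), Htr, HtrB in H.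
  assert (HF : fro n (msub A B) <= 1).
  { pose proof (log_pair_fro_le1 n A LA HA Htr) as H1.
    unfold fro in *. rewrite ip_msub_l, !ip_msub_r, (ip_sym n B A).
    unfold B. rewrite !ip_mscal_l, !ip_mscal_r, (ip_sym n A mone), Htr, ip_mone_mone.
    replace (/ INR n * (/ INR n * INR n)) with (/ INR n) by (field; lra). lra. }
  nra.
Qed.

Theorem theorem4p1
  (n m : nat) (Hn : (2 <= n)%nat) (Hm1 : (1 <= m)%nat) (Hm2 : (m <= n - 1)%nat)
  (Hcop : Nat.gcd m n = 1%nat)
  (x y : Mat) (Hx : hermitian n x) (Hy : hermitian n y)
  (Hux : is_fcalc n (fun r => Cexpi (2 * PI * r / INR n)) x (umat n m))
  (Hvy : is_fcalc n (fun r => Cexpi (2 * PI * r / INR n)) y (vmat n))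
  (t0 : R) (rho : R -> Mat) (L : R -> Mat)
  (Hpos : forall t, t0 <= t -> strictly_positive n (rho t))
  (HL : forall t, t0 <= t -> is_log n (rho t) (L t))
  (Hflow : forall t, t0 <= t -> mderiv_on n t0 rho t (mopp (lap n x y (L t))))
  (Htr : mtr n (rho t0) = Cone) :
  let S := fun t => - Cre (mtr n (mmul n (rho t) (L t))) in
  (forall t, t0 <= t -> meq n (rho t) (mscal (RtoC (/ INR n)) mone))
  \/
  ((forall s t, t0 <= s -> s < t -> S s < S t) /\
   (forall eps, eps > 0 -> exists T, forall t, T <= t -> t0 <= t ->
      Rabs (S t - ln (INR n)) < eps)).
Proof.
  intros S.
  assert (Hn1 : (1 <= n)%nat) by lia.
  assert (HN : 0 < INR n) by (apply lt_0_INR; lia).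
  assert (Hlog : forall t, t0 <= t -> log_pair n (rho t) (L t))
    by (intros; apply is_log_pair; auto).
  assert (Hder : forall t, t0 <= t -> mder n t0 rho t (mopp (lap n x y (L t))))
    by (intros; apply mderiv_on_mder; auto).
  assert (Htrace : forall t, t0 <= t -> ip n mone (rho t) = 1).
  { assert (H0 : ip n mone (rho t0) = 1).
    { rewrite ip_mtr. replace (madj mone) with mone.
      - rewrite mmul_1_l, Htr. reflexivity.
      - mext. unfold madj, mone. rewrite Nat.eqb_sym. destruct (Nat.eqb x1 x0); csolve. }
    assert (H1 : forall t, t0 <= t -> der t0 (fun s => ip n (rho s) mone) t ((fun _ => 0) t)).
    { intros t Ht. replace 0 with (ip n (mopp (lap n x y (L t))) mone).
      - now apply der_ip_const, Hder.
      - rewrite ip_mopp_l, ip_mone_lap by auto. ring. }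
    intros t Ht. destruct Ht as [Ht| <-]; auto.
    destruct (der_MVT _ _ _ t0 t H1 (Rle_refl _) Ht) as (c & _ & E).
    rewrite !(ip_sym n _ mone) in E. lra. }
  set (F := fun t => ip n (rho t) (L t)).
  set (g := fun t => fro n (comm n x (L t)) + fro n (comm n y (L t))).
  assert (ES : forall t, t0 <= t -> S t = - F t).
  { intros t Ht. unfold S, F. rewrite ip_mtr. destruct (Hpos t Ht) as [Hh _].
    red in Hh. now rewrite Hh. }
  assert (HF : forall t, t0 <= t -> der t0 F t (- g t)).
  { intros t Ht. pose proof (der_tr_log n t0 rho L t _ Ht Hlog Htrace (Hder t Ht)) as H.
    rewrite ip_mopp_l, ip_lap in H by auto. exact H. }
  destruct (spectral_gap n m x y Hn1 Hcop Hux Hvy) as (K & HK & Hgap).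
  assert (Hgap' : forall t, t0 <= t -> exists c,
    fro n (msub (L t) (mscal (RtoC c) mone)) <= K * g t).
  { intros t Ht. exists (Cre (L t 0%nat 0%nat)).
    replace (RtoC (Cre (L t 0%nat 0%nat))) with (L t 0%nat 0%nat); [apply Hgap|].
    pose proof (log_pair_hermitian n _ _ (Hlog t Ht) 0%nat 0%nat ltac:(lia) ltac:(lia)) as H.
    unfold madj in H. destruct (L t 0%nat 0%nat) as [a b]. unfold Cconj in H.
    injection H as H. unfold RtoC, Cre; simpl in *. f_equal. lra. }
  assert (Hg : forall t, 0 <= g t).
  { intros t. pose proof (fro_nonneg n (comm n x (L t))).
    pose proof (fro_nonneg n (comm n y (L t))). unfold g. lra. }
  destruct (Classical_Prop.classic
    (exists s, t0 <= s /\ meq n (rho s) (mscal (RtoC (/ INR n)) mone))) as [(s & Hs & E)|Hne].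
  { left. exact (flow_uniform n _ x y _ _ t0 rho L s Hn1 Hux Hvy Hlog Hder Hs E). }
  right.
  (* If the entropy production vanishes, [L t] is a scalar, hence so is [rho t], and the trace
     forces [rho t] to be 1/n. *)
  assert (Hgpos : forall t, t0 <= t -> 0 < g t).
  { intros t Ht. destruct (Hg t) as [|Ez]; auto. exfalso. apply Hne. exists t. split; auto.
    destruct (Hgap' t Ht) as (c & Hc). rewrite <- Ez, Rmult_0_r in Hc.
    assert (EL : meq n (L t) (mscal (RtoC c) mone)).
    { apply fro_msub_eq0. apply Rle_antisym; auto using fro_nonneg. }
    pose proof (log_scalar_inv n _ _ _ (Hlog t Ht) EL) as Er.
    pose proof (Htrace t Ht) as Htt. rewrite Er, ip_mscal_r, ip_mone_mone in Htt.
    replace (/ INR n) with (exp c); auto.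
    apply Rmult_eq_reg_r with (INR n); [|lra]. rewrite Htt. field. lra. }
  assert (Hmono : forall s t, t0 <= s -> s < t -> S s < S t).
  { intros s t Hs Hst. rewrite !ES by lra.
    destruct (der_MVT t0 F (fun t => - g t) s t HF Hs Hst) as (c & Hc & E).
    specialize (Hgpos c ltac:(lra)). nra. }
  split; auto. intros eps He.
  assert (HT : exists T, t0 <= T /\ F T + ln (INR n) < eps).
  { apply Classical_Prop.NNPP. intros Hno.
    (* A gap of at least [eps] gives 2 eps <= eps + w/eps with w = ||L - c||^2, hence eps^2 <= w <=
       K g. *)
    assert (Hbig : forall t, t0 <= t -> eps * eps / K <= g t).
    { intros t Ht. destruct (Hgap' t Ht) as (c & Hc).
      destruct (entropy_gap_bounds n _ _ c Hn1 (Hlog t Ht) (Htrace t Ht)) as [_ H].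
      specialize (H eps He). fold (F t) in H.
      assert (eps <= F t + ln (INR n)).
      { apply Rnot_lt_le. intros Hlt. apply Hno. exists t. auto. }
      set (w := fro n (msub (L t) (mscal (RtoC c) mone))) in *.
      assert (H2 : eps * eps <= w).
      { apply Rmult_le_reg_r with (/ eps); [now apply Rinv_0_lt_compat|].
        replace (eps * eps * / eps) with eps by (field; lra).
        unfold Rdiv in H. lra. }
      apply Rmult_le_reg_l with K; auto.
      replace (K * (eps * eps / K)) with (eps * eps) by (field; lra). lra. }
    (* Chosen so that decay at rate eps^2/K for time [h] exceeds the initial gap by at least 1,
       which would make the nonnegative gap negative. *)
    set (h := (Rabs (F t0 + ln (INR n)) + 1) * K / (eps * eps)).
    assert (Hh : 0 < h).
    { pose proof (Rabs_pos (F t0 + ln (INR n))). unfold h.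
      apply Rdiv_lt_0_compat; [apply Rmult_lt_0_compat; lra | nra]. }
    destruct (der_MVT t0 F (fun t => - g t) t0 (t0 + h) HF (Rle_refl _) ltac:(lra))
      as (c & Hc & E).
    specialize (Hbig c ltac:(lra)).
    destruct (entropy_gap_bounds n _ _ 0 Hn1 (Hlog (t0 + h) ltac:(lra))
      (Htrace (t0 + h) ltac:(lra))) as [H _]. fold (F (t0 + h)) in H.
    assert (Eh : eps * eps / K * h = Rabs (F t0 + ln (INR n)) + 1) by (unfold h; field; lra).
    pose proof (Rle_abs (F t0 + ln (INR n))). nra. }
  destruct HT as (T & HT0 & HT). exists T. intros t HTt Ht.
  destruct (entropy_gap_bounds n _ _ 0 Hn1 (Hlog t Ht) (Htrace t Ht)) as [H _].
  fold (F t) in H. rewrite ES by auto.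
  assert (F t <= F T).
  { destruct HTt as [Hlt| ->]; [|lra]. specialize (Hmono T t HT0 Hlt).
    rewrite !ES in Hmono by auto. lra. }
  apply Rabs_def1; lra.
Qed.
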